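(* For every integer $k \in \{1,2,3,4\}$: (1) for every tournament $T$ with $|V(T)| \geq 3+k$, there exists $X \subseteq V(T)$ with $|X| = k$ and $\Delta(T) \leq \Delta(T-X)+2$; (2) for every tournament $T$ with $|V(T)| \geq 5+k$, there exists $X \subseteq V(T)$ with $|X| = k$ and $\delta(T) \leq \delta(T-X)+1$.
   Context: A tournament $T$ is a finite vertex set $V(T)$ with an arc set $A(T)$ such that for all distinct $x,y$, exactly one of $(x,y),(y,x)$ lies in $A(T)$. $T-X$ is the subtournament induced on $V(T)\setminus X$. A module of $T$ is a subset $M \subseteq V(T)$ such that for all $x,y \in M$ and $v \notin M$, $(v,x)\in A(T)$ iff $(v,y)\in A(T)$; trivial modules are $\emptyset$, singletons and $V(T)$; $T$ is indecomposable if all its modules are trivial. For $B \subseteq A(T)$, ${\rm Inv}(T,B)$ is obtained by reversing every arc of $B$. For $T$ with at least five vertices, $\delta(T)$ is the least $m$ such that some $B \subseteq A(T)$ with $|B|=m$ makes ${\rm Inv}(T,B)$ indecomposable. With $\overline{X} = V(T)\setminus X$, a co-module of $T$ is a set $M$ such that $M$ or $\overline{M}$ is a nontrivial module; a co-modular decomposition is a set of pairwise disjoint co-modules; $\Delta(T)$ is the largest size of a co-modular decomposition. *)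

(* Defs.v *)
From HB Require Import structures.
From mathcomp Require Import all_boot.

Set Implicit Arguments.
Unset Strict Implicit.
Unset Printing Implicit Defensive.

Record tournament (V : finType) := Tournament {
  arcs : {set V * V};
  arcs_irr : forall x : V, (x, x) \notin arcs;
  arcs_xor : forall x y : V, x != y -> ((x, y) \in arcs) (+) ((y, x) \in arcs)
}.

Section Subtournament.
Variables (V : finType) (T : tournament V) (X : {set V}).

Definition del_arcs : {set {x : V | x \notin X} * {x : V | x \notin X}} :=
  [set p | (val p.1, val p.2) \in arcs T].

Fact del_irr x : (x, x) \notin del_arcs.
Proof. by rewrite inE arcs_irr. Qed.

Fact del_xor x y : x != y -> ((x, y) \in del_arcs) (+) ((y, x) \in del_arcs).
Proof. by move=> xy; rewrite !inE /=; apply: arcs_xor. Qed.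

(* T - X *)
Definition del : tournament {x : V | x \notin X} := Tournament del_irr del_xor.
End Subtournament.

Section Inversion.
Variables (V : finType) (T : tournament V) (B : {set V * V}).

(* B is cut down to arcs T, so that the result is a tournament for every B *)
Definition inv_arcs : {set V * V} :=
  (arcs T :\: B) :|: [set (p.2, p.1) | p in arcs T :&: B].

Lemma mem_inv_arcs x y :
  ((x, y) \in inv_arcs) =
  ((x, y) \in arcs T) && ((x, y) \notin B)
  || ((y, x) \in arcs T) && ((y, x) \in B).
Proof.
rewrite !inE [in X in X || _]andbC; congr (_ || _).
apply/imsetP/idP => [[[a b]] /= + [-> ->]|yxAB]; first by rewrite inE.
by exists (y, x); rewrite ?inE.
Qed.

Fact inv_irr x : (x, x) \notin inv_arcs.
Proof. by rewrite mem_inv_arcs (negPf (arcs_irr T x)). Qed.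

Fact inv_xor x y : x != y -> ((x, y) \in inv_arcs) (+) ((y, x) \in inv_arcs).
Proof.
move=> /(arcs_xor T); rewrite !mem_inv_arcs.
by do 4![case: (_ \in _)].
Qed.

(* Inv(T, B) *)
Definition inv : tournament V := Tournament inv_irr inv_xor.
End Inversion.

Section Modules.
Variables (V : finType) (T : tournament V).

Definition is_module (M : {set V}) : bool :=
  [forall x in M, forall y in M, forall v in ~: M,
    ((v, x) \in arcs T) == ((v, y) \in arcs T)].

Definition trivial_set (M : {set V}) : bool :=
  [|| M == set0, #|M| == 1 | M == [set: V]].

Definition nontrivial_module (M : {set V}) : bool :=
  is_module M && ~~ trivial_set M.

Definition indecomposable : bool :=
  [forall M : {set V}, is_module M ==> trivial_set M].

Definition comodule (M : {set V}) : bool :=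
  nontrivial_module M || nontrivial_module (~: M).

Definition comodular_decomposition (D : {set {set V}}) : bool :=
  trivIset D && [forall M in D, comodule M].

Definition Delta : nat :=
  \max_(D : {set {set V}} | comodular_decomposition D) #|D|.
End Modules.

(* The neutral value #|arcs T| bounds every #|B|, so this is exactly the least
   cardinal whenever some B makes Inv(T, B) indecomposable, as is always the
   case on at least five vertices *)
Definition delta (V : finType) (T : tournament V) : nat :=
  \big[minn/#|arcs T|]_(B : {set V * V} |
      (B \subset arcs T) && indecomposable (inv T B)) #|B|.

Lemma delta_le (V : finType) (T : tournament V) (B : {set V * V}) :
  B \subset arcs T -> indecomposable (inv T B) -> delta T <= #|B|.
Proof.
move=> sB iB; rewrite /delta; have := mem_index_enum B.
elim: (index_enum _) => // C s IHs; rewrite inE big_cons => /orP[/eqP <-|/IHs le].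
  by rewrite sB iB geq_minl.
by case: ifP => // _; rewrite geq_min le orbT.
Qed.

Lemma delta_attained (V : finType) (T : tournament V) :
  (exists2 B : {set V * V}, B \subset arcs T & indecomposable (inv T B)) ->
  exists B : {set V * V},
    [/\ B \subset arcs T, indecomposable (inv T B) & #|B| = delta T].
Proof.
case=> B0 sB0 iB0.
have [|[B [sB iB cB]]] : delta T = #|arcs T| \/
  exists B : {set V * V},
    [/\ B \subset arcs T, indecomposable (inv T B) & #|B| = delta T].
- rewrite /delta; elim/big_ind: _ => [|m n Hm Hn|B /andP[]]; first by left.
    by rewrite /minn; case: ifP.
  by right; exists B.
- move=> dA; exists B0; split=> //; apply/eqP.
  by rewrite eqn_leq delta_le // dA subset_leq_card.
- by exists B.
Qed.

(* Main.v *)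
Require Import Defs.
From mathcomp Require Import all_boot.

(** If [Inv(T, B)] is indecomposable, then some arc of [B] has exactly one end in
    each given co-module, whence [Delta T <= 2 * delta T].  Conversely [delta T <= ceil (Delta T / 2)]
    on at least five vertices.  There are [Delta T] disjoint minimal co-modules
    with representatives that hit all co-modules.  Reversing the arc between two
    representatives [x] and [y] creates, apart from a few configurations treated
    separately, no new co-module and destroys those separating [x] from [y].  As
    co-modules cannot split four points in all three ways, an exchange argument
    pairs the representatives so that every co-module separates some pair;
    reversing the arcs of these pairs gives an indecomposable tournament.  When
    [Delta T] is odd, one first reverses an arc that lowers [Delta].

    Hence (2) follows from (1).  For (1), choose [X] inside two members of a
    maximum decomposition, the others staying co-modules of [T - X]; when
    [Delta T = 3] it suffices that [T - X] is decomposable. *)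

Set Implicit Arguments.
Unset Strict Implicit.
Unset Printing Implicit Defensive.

(** The obstacle is that a reversed arc may create modules. Only a set containing exactly one of
    [x], [y] can be affected; seen in [T], a new module of this kind is an [almost_module], and
    [good T x y] says that only singletons are of this form. After a good flip the co-modules are
    therefore exactly the old ones that do not separate [x] from [y], so pairs can be flipped one
    after another.

    Goodness is not checked pair by pair. Once every co-module separates some pair, a co-module
    inside the union of the two minimal co-modules at [x] and [y] contains no other end, hence must
    separate [x] from [y]; the sets that could spoil goodness lie inside this union and do not. This
    breaks down only if the two minimal co-modules cover [V]. They are then the only co-modules, and
    one well-chosen arc between them suffices.

    An odd number of representatives admits no perfect pairing. *)

Definition arc (V : finType) (T : tournament V) : rel V :=
  fun u v => (u, v) \in arcs T.

Definition flip (V : finType) (T : tournament V) (x y : V) : tournament V :=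
  Defs.inv T [set (x, y); (y, x)].

(** * Modules and minimal co-modules *)

Section Modules.
Variables (V : finType).
Implicit Types (T : tournament V) (M N K A B C Q : {set V}) (x y u v w : V).

Lemma arcxx T x : arc T x x = false.
Proof. exact/negbTE/arcs_irr. Qed.

Lemma arcN T u v : u != v -> arc T u v = ~~ arc T v u.
Proof.
by move/(arcs_xor T); rewrite /arc; case: (_ \in _); case: (_ \in _).
Qed.

Lemma arc_neq T u v : arc T u v -> u != v.
Proof. by apply: contraTneq => ->; rewrite arcxx. Qed.

Lemma moduleP T M :
  reflect (forall x y v, x \in M -> y \in M -> v \notin M ->
             arc T v x = arc T v y)
          (is_module T M).
Proof.
apply: (iffP forall_inP) => [H x y v xM yM vM | H x xM].
  have /forall_inP/(_ y yM)/forall_inP/(_ v) := H x xM.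
  by rewrite inE => /(_ vM)/eqP.
apply/forall_inP => y yM; apply/forall_inP => v; rewrite inE => vM.
by apply/eqP; apply: H.
Qed.

Lemma mem_neq M x v : x \in M -> v \notin M -> x != v.
Proof. by move=> xM; apply: contraNneq => <-. Qed.

Lemma module_in T M x y v : is_module T M ->
  x \in M -> y \in M -> v \notin M -> arc T v x = arc T v y.
Proof. by move/moduleP; apply. Qed.

Lemma module_out T M x y v : is_module T M ->
  x \in M -> y \in M -> v \notin M -> arc T x v = arc T y v.
Proof.
move=> mM xM yM vM; rewrite arcN ?(mem_neq xM vM) //.
by rewrite (module_in mM xM yM vM) -arcN // (mem_neq yM vM).
Qed.

Lemma modules_arc T M N x x' y y' : is_module T M -> is_module T N ->
  [disjoint M & N] -> x \in M -> x' \in M -> y \in N -> y' \in N ->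
  arc T x y = arc T x' y'.
Proof.
move=> mM mN dMN xM x'M yN y'N.
have nM z : z \in N -> z \notin M by move=> zN; rewrite (disjointFl dMN).
have nN z : z \in M -> z \notin N by move=> zN; rewrite (disjointFr dMN).
by rewrite (module_out mM xM x'M (nM _ yN)) (module_in mN yN y'N (nN _ x'M)).
Qed.

Lemma module_setI T A B :
  is_module T A -> is_module T B -> is_module T (A :&: B).
Proof.
move=> mA mB; apply/moduleP => x y v; rewrite !inE negb_and.
move=> /andP[xA xB] /andP[yA yB] /orP[]; [exact: module_in|exact: module_in].
Qed.

Lemma module_setU T A B z : is_module T A -> is_module T B ->
  z \in A -> z \in B -> is_module T (A :|: B).
Proof.
move=> mA mB zA zB; apply/moduleP => x y v; rewrite !inE negb_or.
have key u : (u \in A) || (u \in B) -> (v \notin A) && (v \notin B) ->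
    arc T v u = arc T v z.
  by case/orP=> uX /andP[vA vB]; [apply: (module_in mA)|apply: (module_in mB)].
by move=> hx hy hv; rewrite (key x) ?(key y).
Qed.

(** A vertex of [A :&: B] is related to each vertex of [A :\: B] as [z] is, both being in [B]; and
    [z], being outside [A], sees all of [A] alike. *)
Lemma module_setD T A B z : is_module T A -> is_module T B ->
  z \in B -> z \notin A -> is_module T (A :\: B).
Proof.
move=> mA mB zB zA; apply/moduleP => x y v; rewrite !inE.
move=> /andP[xB xA] /andP[yB yA]; rewrite negb_and negbK.
have [vA|vA _] := boolP (v \in A); last exact: module_in mA _ _ _.
rewrite orbF => vB.
rewrite (module_out mB vB zB xB) (module_out mB vB zB yB).
exact: module_in mA _ _ _.
Qed.

Lemma nontrivialP T M :
  reflect [/\ is_module T M, 1 < #|M| & exists v, v \notin M]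
          (nontrivial_module T M).
Proof.
rewrite /nontrivial_module /trivial_set !negb_or -cards_eq0.
apply: (iffP and4P) => [[mM M0 M1 MT]|[mM M1 [v vM]]]; split=> //.
- by case: #|M| M0 M1 => [|[]].
- apply/existsP; rewrite -negb_forall; apply: contra MT => /forallP MT.
  by apply/eqP/setP => v; rewrite inE MT.
- by case: #|M| M1.
- by case: #|M| M1 => [|[]].
- by apply: contraNneq vM => ->; rewrite inE.
Qed.

Lemma nontrivial_module_module T M : nontrivial_module T M -> is_module T M.
Proof. by case/andP. Qed.

Lemma nontrivial_module_gt1 T M : nontrivial_module T M -> 1 < #|M|.
Proof. by case/nontrivialP. Qed.

Lemma card_gt1_ex M x : 1 < #|M| -> exists2 y, y \in M & y != x.
Proof.
case/card_gt1P => a [b [aM bM ab]].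
have [ax|ax] := eqVneq a x; last by exists a.
by exists b => //; rewrite -ax eq_sym.
Qed.

Lemma comoduleC T M : comodule T (~: M) = comodule T M.
Proof. by rewrite /comodule setCK orbC. Qed.

Lemma comodule_neq0 T M : comodule T M -> exists x, x \in M.
Proof.
case/orP => /nontrivialP[_ gt1 [v]]; last by rewrite inE negbK; exists v.
by move=> _; have /card_gt0P := ltnW gt1.
Qed.

Lemma comodule_compl T M : comodule T M -> exists x, x \notin M.
Proof. by rewrite -comoduleC => /comodule_neq0[x]; rewrite inE; exists x. Qed.

Lemma module_comodule T M v :
  is_module T M -> 1 < #|M| -> v \notin M -> comodule T M.
Proof. by move=> mM gM vM; apply/orP; left; apply/nontrivialP; split=> //; exists v. Qed.

Lemma module_comoduleC T M x :
  is_module T (~: M) -> 1 < #|~: M| -> x \in M -> comodule T M.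
Proof.
move=> mM gM xM; rewrite -comoduleC; apply: (module_comodule mM gM (v := x)).
by rewrite inE xM.
Qed.

Lemma indecomposableP T :
  reflect (forall C, ~~ comodule T C) (indecomposable T).
Proof.
apply: (iffP forallP) => [H C|H C].
  rewrite /comodule /nontrivial_module negb_or !negb_and !negbK.
  by rewrite -!implybE !H.
by have:= H C; rewrite /comodule negb_or negb_and negbK -implybE => /andP[].
Qed.

(** [M] is the difference of the modules [~: N] and [~: M]. This turns disjoint co-modules known
    only through their complements into modules. *)
Lemma comodules_modules T M N v : [disjoint M & N] -> v \notin M :|: N ->
  is_module T (~: M) -> is_module T (~: N) ->  N != set0 -> is_module T M.
Proof.
move=> dMN; rewrite inE negb_or => /andP[vM vN] mM mN /set0Pn[z zN].
suff -> : M = ~: N :\: ~: M.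
  by apply: (module_setD mN mM (z := z)); rewrite !inE ?zN // (disjointFl dMN).
apply/setP => u; rewrite !inE negbK.
by case uM: (u \in M); rewrite //= (disjointFr dMN).
Qed.

Lemma module_setD1 T M y b : is_module T M -> y \in M ->
  (forall v, v \in M -> v != y -> arc T y v = b) -> is_module T (M :\ y).
Proof.
move=> mM yM yb; apply/moduleP => u w v; rewrite !inE.
move=> /andP[uy uM] /andP[wy wM]; rewrite negb_and negbK.
have [->|vy /= vM] := eqVneq v y; first by rewrite !yb.
exact: module_in mM _ _ _.
Qed.

Definition mincom T M := minset (comodule T) M.

Lemma mincom_comodule T M : mincom T M -> comodule T M.
Proof. by case/minsetP. Qed.

Lemma mincom_sub T M C : mincom T M -> comodule T C -> C \subset M -> C = M.
Proof. by case/minsetP => _; apply. Qed.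

Lemma mincom_exists T C : comodule T C -> exists2 M, mincom T M & M \subset C.
Proof. by case/minset_exists => M; exists M. Qed.

Lemma subset_neq_ex M N : ~~ (M \subset N) -> exists2 x, x \in M & x \notin N.
Proof. by case/subsetPn => x; exists x. Qed.

Lemma mincom_small T M C v : mincom T M -> C \subset M -> v \in M ->
  v \notin C -> is_module T C -> #|C| <= 1.
Proof.
move=> mM sCM vM vC mC; rewrite leqNgt; apply/negP => gC.
have cC := module_comodule mC gC vC.
by move: vC; rewrite (mincom_sub mM cC sCM) vM.
Qed.

(** If both sets are modules, so are [M :&: N] and the two differences; by minimality these pieces
    have at most one element. If a complement is the module instead, some piece is a smaller
    co-module, or [M] and [N] turn out to be complementary. *)
Lemma mincom_overlap T M N z : mincom T M -> mincom T N -> M != N ->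
  z \in M -> z \in N ->
  [/\ #|M| = 2, #|N| = 2, is_module T M & is_module T N].
Proof.
move=> mM mN nMN zM zN.
have /subset_neq_ex[x xM xN]: ~~ (M \subset N).
  by apply: contra nMN => sMN; rewrite (mincom_sub mN (mincom_comodule mM) sMN).
have /subset_neq_ex[y yN yM]: ~~ (N \subset M).
  by apply: contra nMN => s; rewrite (mincom_sub mM (mincom_comodule mN) s).
have mixed A B u : mincom T A -> mincom T B -> z \in A -> z \in B ->
    u \in B -> u \notin A -> (exists2 t, t \in A & t \notin B) ->
    is_module T A -> is_module T (~: B) -> False.
  move=> mA mB zA zB uB uA [t tA tB] modA modB.
  have modU : is_module T (A :|: ~: B).
    by apply: (module_setU modA modB (z := t)); rewrite ?inE.
  have cD : comodule T (B :\: A).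
    have <- : ~: (A :|: ~: B) = B :\: A by apply/setP=> v; rewrite !inE negb_or negbK.
    rewrite comoduleC; apply: (module_comodule modU (v := u)); last first.
      by rewrite !inE negb_or uA uB.
    apply/card_gt1P; exists z, t; split; rewrite ?inE ?zA ?tA //.
    by apply: contraNneq tB => <-.
  have : z \in B :\: A by rewrite (mincom_sub mB cD (subsetDl _ _)).
  by rewrite inE zA.
case/orP: (mincom_comodule mM) => /nontrivialP[modM gM _];
case/orP: (mincom_comodule mN) => /nontrivialP[modN gN _].
- have small A B u t : mincom T A -> is_module T A -> is_module T B ->
      z \in A -> z \in B -> u \in B -> u \notin A -> t \in A -> t \notin B ->
      #|A| <= 2.
    move=> mA mdA mdB zA zB uB uA tA tB.
    rewrite -(cardsID B A).
    have := @mincom_small T A (A :&: B) t mA (subsetIl _ _) tA.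
    rewrite inE negb_and tB orbT => /(_ isT (module_setI mdA mdB)).
    have := @mincom_small T A (A :\: B) z mA (subsetDl _ _) zA.
    rewrite inE zB => /(_ isT (module_setD mdA mdB uB uA)).
    by move=> hD hI; apply: (leq_add hI hD).
  split=> //; apply/eqP; rewrite eqn_leq.
    by rewrite gM (small M N y x).
  by rewrite gN (small N M x y).
- by case: (mixed M N y) => //; exists x.
- by case: (mixed N M x) => //; exists y.
- have [/existsP[t /andP[tM tN]]|/existsPn no] :=
      boolP [exists t, (t \notin M) && (t \notin N)].
    have modU : is_module T (~: M :|: ~: N).
      by apply: (module_setU modM modN (z := t)); rewrite ?inE.
    have cI : comodule T (M :&: N).
      rewrite -comoduleC setCI; apply: (module_comodule modU (v := z)).
        by apply: leq_trans gM _; rewrite subset_leq_card // subsetUl.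
      by rewrite !inE zM zN.
    have : x \in M :&: N by rewrite (mincom_sub mM cI (subsetIl _ _)).
    by rewrite inE (negbTE xN) andbF.
  have cM : comodule T (~: M) by rewrite comoduleC mincom_comodule.
  have sMN : ~: M \subset N.
    by apply/subsetP => t; rewrite inE => tM; have := no t; rewrite tM /= negbK.
  by move: zN; rewrite -(mincom_sub mN cM sMN) inE zM.
Qed.

End Modules.
(** * Reversing one arc *)

Section Flips.
Variables (V : finType).
Implicit Types (T : tournament V) (M N K A B C Q : {set V}) (x y u v w : V).

Lemma arc_flip T x y u v : x != y ->
  arc (flip T x y) u v =
  arc T u v (+) ((u == x) && (v == y) || (u == y) && (v == x)).
Proof.
move=> xy; rewrite /arc /= mem_inv_arcs !inE !xpair_eqE -!/(arc T _ _).
have [->|uv] := eqVneq u v.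
  rewrite arcxx /=.
  by have [->|_] := eqVneq v x; rewrite ?(negbTE xy) ?andbF.
rewrite (arcN _ uv) [(v == x) && _]andbC [(v == y) && _]andbC.
move: (arc T v u) ((u == x) && _) ((u == y) && _) => a p q.
by case: a; case: p; case: q.
Qed.

Lemma flipC T x y : flip T x y = flip T y x.
Proof. by rewrite /flip setUC. Qed.

Definition separates K x y := (x \in K) != (y \in K).

Lemma separates_setC K x y : separates (~: K) x y = separates K x y.
Proof. by rewrite /separates !inE (inj_eq negb_inj). Qed.

Lemma module_flip T x y K : x != y -> ~~ separates K x y ->
  is_module (flip T x y) K = is_module T K.
Proof.
rewrite /separates negbK => xy /eqP sK.
have key u v : u \in K -> v \notin K -> arc (flip T x y) v u = arc T v u.
  move=> uK vK; rewrite arc_flip //.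
  suff -> : (v == x) && (u == y) || (v == y) && (u == x) = false by rewrite addbF.
  apply/negbTE; apply: contra vK => /orP[] /andP[/eqP-> /eqP e].
    by rewrite sK -e.
  by rewrite -sK -e.
by apply/moduleP/moduleP => H u w v uK wK vK;
  have := H _ _ _ uK wK vK; rewrite !key.
Qed.

Lemma comodule_flip T x y K : x != y -> ~~ separates K x y ->
  comodule (flip T x y) K = comodule T K.
Proof.
move=> xy sK; rewrite /comodule /nontrivial_module !module_flip //.
by rewrite separates_setC.
Qed.

(* What a module of [flip T x y] with [x] inside and [y] outside looks like in
   [T]: only [y] distinguishes its elements, and it isolates [x]. *)
Definition almost_module T K x y :=
  [/\ x \in K, y \notin K,
      forall v a b, a \in K -> b \in K -> v \notin K -> v != y ->
        arc T v a = arc T v b &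
      forall w, w \in K -> w != x -> arc T y w = arc T x y].

Lemma almost_module_of_flip T K x y :
  is_module (flip T x y) K -> x \in K -> y \notin K -> almost_module T K x y.
Proof.
move=> mK xK yK; have xy := mem_neq xK yK; split=> // [v a b aK bK vK vy|w wK wx].
  have := module_in mK aK bK vK; rewrite !arc_flip // (negbTE vy).
  by rewrite eq_sym (negbTE (mem_neq xK vK)) !addbF.
have := module_in mK wK xK yK; rewrite !arc_flip // !eqxx (negbTE wx).
rewrite andbF [y == x]eq_sym (negbTE xy) /= addbF addbT.
by rewrite [arc T x y]arcN.
Qed.

Definition good T x y := forall K w,
  (almost_module T K x y -> w \in K -> w = x) /\
  (almost_module T K y x -> w \in K -> w = y).

Lemma goodC T x y : good T x y -> good T y x.
Proof. by move=> g K w; have [] := g K w. Qed.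

Lemma good_module T x y K : x != y -> good T x y ->
  is_module (flip T x y) K -> 1 < #|K| -> ~~ separates K x y.
Proof.
move=> xy g mK gK; apply/negP; rewrite /separates.
case xK: (x \in K); case yK: (y \in K) => // _.
  have [w wK /eqP] := card_gt1_ex x gK; case; apply: (g K w).1 => //.
  by apply: almost_module_of_flip; rewrite ?yK.
have [w wK /eqP] := card_gt1_ex y gK; case; apply: (g K w).2 => //.
by apply: almost_module_of_flip; rewrite ?xK // flipC.
Qed.

Lemma good_comodule T x y C : x != y -> good T x y ->
  comodule (flip T x y) C -> comodule T C /\ ~~ separates C x y.
Proof.
move=> xy g cC; have nsC : ~~ separates C x y; last first.
  by rewrite -(comodule_flip T xy).
case/orP: cC => /nontrivialP[mC gC _]; first exact: good_module mC gC.
by rewrite -separates_setC; exact: good_module mC gC.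
Qed.

(** [y] sees all of [M] as it sees [x], but sees the rest of [K] the other way, so [K] meets [M]
    only in [x]. If [n] is outside [K], it sees [K] uniformly, and a [w] outside [N] would be seen
    by [y] as [x] is. *)
Lemma almost_module_meet T M N K x y w n : is_module T M -> is_module T N ->
  [disjoint M & N] -> x \in M -> y \in N -> n \in N -> n != y ->
  almost_module T K x y -> w \in K -> w != x ->
  (forall u, u \in K -> u \in M -> u = x) /\ exists2 u, u \in K & u \in N.
Proof.
move=> mM mN dMN xM yN nN ny [xK yK uni iso] wK wx.
have xy := mem_neq xK yK.
have KM u : u \in K -> u \in M -> u = x.
  move=> uK uM; apply/eqP; apply: contraT => ux.
  have := iso u uK ux; rewrite arcN; last by rewrite eq_sym (mem_neq uK yK).
  by rewrite (modules_arc mM mN dMN uM xM yN yN); case: arc.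
split=> //; have [nK|nK] := boolP (n \in K); first by exists n.
exists w => //; apply: contraT => wN.
have := uni n w x wK xK nK ny.
rewrite (module_out mN nN yN wN) (iso w wK wx).
by rewrite (modules_arc mM mN dMN xM xM yN nN) arcN ?(mem_neq xK nK) //; case: arc.
Qed.

(** A vertex [v] outside [M :|: N] must not tell [x] from [y]. If [v] is outside [K], it sees [x] as
    it sees a vertex of [K :&: N]. If [v] is in [K], its arc to [y] is known by isolation, and its
    arc to [x] through [a] or because [x] is extreme. *)
Lemma almost_module_union T M N K x y w n : is_module T M -> is_module T N ->
  [disjoint M & N] -> x \in M -> y \in N -> n \in N -> n != y ->
  (exists2 a, a \in M & a != x) \/ (forall v, v != x -> arc T x v = arc T x y) ->
  almost_module T K x y -> w \in K -> w != x -> is_module T (M :|: N).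
Proof.
move=> mM mN dMN xM yN nN ny hM aK wK wx.
have [KM [u uK uN]] := almost_module_meet mM mN dMN xM yN nN ny aK wK wx.
have {aK} [xK yK uni iso] := aK.
have key v : v \notin M -> v \notin N -> arc T v x = arc T v y.
  move=> vM vN; have vy : y != v by apply: mem_neq yN vN.
  have xv : x != v by apply: mem_neq xM vM.
  have [vK|vK] := boolP (v \in K); last first.
    rewrite (uni v x u xK uK vK); last by rewrite eq_sym.
    exact: module_in mN _ _ _.
  apply: negb_inj; rewrite -!arcN // (iso v vK); last by rewrite eq_sym.
  case: hM => [[a aM ax]|->//]; last by rewrite eq_sym.
  have aK : a \notin K by apply: contra ax => aK; rewrite (KM a).
  rewrite (module_out mM xM aM vM) (uni a v u vK uK aK); last first.
    by apply: mem_neq aM _; rewrite (disjointFl dMN).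
  exact: (modules_arc mM mN).
apply/moduleP => p q v; rewrite !inE negb_or => hp hq /andP[vM vN].
have aux p' : (p' \in M) || (p' \in N) -> arc T v p' = arc T v x.
  case/orP=> p'M; first exact: module_in mM _ _ _.
  rewrite key //; exact: module_in mN _ _ _.
by rewrite !aux.
Qed.

Lemma good_modules T M N x y : is_module T M -> is_module T N ->
  1 < #|M| -> 1 < #|N| -> [disjoint M & N] -> x \in M -> y \in N ->
  ~~ is_module T (M :|: N) -> good T x y.
Proof.
move=> mM mN gM gN dMN xM yN nU K w.
have [a aM ax] := card_gt1_ex x gM; have [n nN ny] := card_gt1_ex y gN.
split=> aK wK; apply/eqP; apply: contraT => wx; case/negP: nU.
  apply: (almost_module_union mM mN dMN xM yN nN ny _ aK wK wx).
  by left; exists a.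
rewrite setUC; rewrite disjoint_sym in dMN.
apply: (almost_module_union mN mM dMN yN xM aM ax _ aK wK wx).
by left; exists n.
Qed.

(** This covers the case where [M :|: N] is a module, on which [good_modules] is silent: [v] stays
    outside [K], yet sees [x] and a vertex of [K :&: N] in opposite ways. *)
Lemma good_nonextreme T M N x y v n : is_module T M -> is_module T N ->
  [disjoint M & N] -> x \in M -> y \in N -> v \in M -> n \in N ->
  v != x -> n != y -> arc T x v = arc T x y -> arc T n y = arc T x y ->
  good T x y.
Proof.
move=> mM mN dMN xM yN vM nN vx ny exv eny.
have half M' N' x' y' v' n' K w : is_module T M' -> is_module T N' ->
    [disjoint M' & N'] -> x' \in M' -> y' \in N' -> v' \in M' -> n' \in N' ->
    v' != x' -> n' != y' -> arc T x' v' = arc T x' y' ->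
    almost_module T K x' y' -> w \in K -> w = x'.
  move=> mM' mN' d xM' yN' vM' nN' vx' ny' e aK wK; apply/eqP; apply: contraT => wx.
  have [KM [u uK uN]] := almost_module_meet mM' mN' d xM' yN' nN' ny' aK wK wx.
  have {aK} [xK yK uni iso] := aK.
  have vK : v' \notin K by apply: contra vx' => vK; rewrite (KM v').
  have vy : v' != y' by apply: mem_neq vM' _; rewrite (disjointFl d).
  have := uni v' u x' uK xK vK vy.
  rewrite (modules_arc mM' mN' d vM' xM' uN yN') -e [arc T x' v']arcN.
    by case: arc.
  by rewrite eq_sym.
move=> K w; split; first exact: (half M N x y v n).
have xy : x != y by apply: mem_neq xM _; rewrite (disjointFl dMN).
apply: (half N M y x n v) => //; first by rewrite disjoint_sym.
by rewrite arcN 1?eq_sym // eny -arcN // eq_sym.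
Qed.

Lemma module1 T x : is_module T [set x].
Proof. by apply/moduleP => a b v; rewrite !inE => /eqP-> /eqP->. Qed.

Lemma good_homogeneous T N x y b : (forall v, v != x -> arc T x v = b) ->
  is_module T N -> 1 < #|N| -> x \notin N -> y \in N ->
  ~~ is_module T (x |: N) -> good T x y.
Proof.
move=> hx mN gN xN yN nU K w; have [n nN ny] := card_gt1_ex y gN.
have yx : y != x by apply: mem_neq yN xN.
split=> aK wK; apply/eqP; apply: contraT => wx.
  case/negP: nU.
  apply: (@almost_module_union T [set x] N K x y w n) => //.
  - exact: module1.
  - by rewrite disjoints1.
  - by rewrite inE.
  - by right=> v vx; rewrite !hx.
case: aK => yK xK _ /(_ w wK wx); rewrite hx ?(mem_neq wK xK) //.
by rewrite arcN // hx //; case: (b).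
Qed.

Lemma good_source_sink T x y b : x != y -> (forall v, v != x -> arc T x v = b) ->
  (forall v, v != y -> arc T v y = b) -> good T x y.
Proof.
move=> xy hx hy K w.
split=> -[zK tK _ iso] wK; apply/eqP; apply: contraT => wx.
  have := iso w wK wx; rewrite hx 1?eq_sym // arcN; last first.
    by rewrite eq_sym (mem_neq wK tK).
  by rewrite hy ?(mem_neq wK tK) //; case: (b).
have := iso w wK wx; rewrite hx ?(mem_neq wK tK) // [arc T y x]arcN 1?eq_sym //.
by rewrite hx 1?eq_sym //; case: (b).
Qed.

(** Let [K] be a larger almost module at [x]. If it has another vertex outside [Q], it swallows [Q]
    except [y], and [y] would see [q1] and [q2] alike; otherwise [x |: Q] is a module. One at [y]
    avoids the rest of [Q], so [q1] and [q2] would be related alike to [y]. *)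
Lemma good_outside T Q x y q1 q2 : is_module T Q -> x \notin Q -> y \in Q ->
  q1 \in Q -> q2 \in Q -> arc T y q1 -> arc T q2 y ->
  ~~ is_module T (x |: Q) -> good T x y.
Proof.
move=> mQ xQ yQ q1Q q2Q yq1 q2y nU K w.
have q1y : q1 != y by rewrite eq_sym (arc_neq yq1).
have q2y' : q2 != y by rewrite (arc_neq q2y).
have xq q : q \in Q -> arc T x q = arc T x y by move=> qQ; apply: module_in mQ _ _ _.
have yx : y != x by apply: mem_neq yQ xQ.
split=> -[zK tK uni iso] wK; apply/eqP; apply: contraT => wx.
  have Qx : forall q, q \in Q -> q != x by move=> q qQ; apply: mem_neq qQ xQ.
  have [/existsP[m /and3P[mK mQ' mx]]|/existsPn no] :=
      boolP [exists m, [&& m \in K, m \notin Q & m != x]]; last first.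
    case/negP: nU; apply/moduleP.
    have wQ : w \in Q by have := no w; rewrite wK wx andbT /= negbK.
    have key v p : v \notin x |: Q -> p \in x |: Q -> arc T v p = arc T v w.
      rewrite !inE negb_or => /andP[vx vQ] /orP[/eqP->|pQ]; last first.
        exact: module_in mQ _ _ _.
      apply: uni => //; last by rewrite eq_sym (mem_neq yQ vQ).
      by have := no v; rewrite vQ vx !andbT.
    by move=> p q v hp hq hv; rewrite !(key v).
  have inK q : q \in Q -> q != y -> q \in K.
    move=> qQ qy; apply: contraT => qK.
    have := uni q m x mK zK qK qy.
    rewrite (module_out mQ qQ yQ mQ') (iso m mK mx) [arc T q x]arcN; last exact: Qx.
    by rewrite xq //; case: arc.
  have := iso q1 (inK _ q1Q q1y) (Qx _ q1Q).
  have := iso q2 (inK _ q2Q q2y') (Qx _ q2Q).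
  by rewrite arcN 1?eq_sym // q2y yq1 => <-.
have out q : q \in Q -> q != y -> q \notin K.
  move=> qQ qy; apply/negP => qK; have := iso q qK qy.
  by rewrite xq // [arc T y x]arcN //; case: arc.
have wQ : w \notin Q by apply: contraL wK => wQ; apply: out.
have qx q : q \in Q -> q != x by move=> qQ; apply: mem_neq qQ xQ.
have key q : q \in Q -> q != y -> arc T q y = arc T y w.
  move=> qQ qy; rewrite (uni q y w zK wK (out q qQ qy) (qx q qQ)).
  exact: module_out mQ _ _ _.
have := key q1 q1Q q1y; have := key q2 q2Q q2y'.
by rewrite q2y [arc T q1 y]arcN // yq1 => <-.
Qed.

(** A singleton co-module is a source or a sink; [b] tells which. *)
Lemma homogeneous_of_module T x : is_module T (~: [set x]) ->
  exists b, forall v, v != x -> arc T x v = b.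
Proof.
move=> mx; have [/existsP[u ux]|/existsPn no] := boolP [exists u, u != x].
  exists (arc T x u) => v vx.
  by apply: (module_in mx); rewrite !inE ?negbK.
by exists true => v vx; have := no v; rewrite vx.
Qed.

Lemma good_homogeneous2 T x y : x != y -> is_module T (~: [set x]) ->
  is_module T (~: [set y]) -> good T x y.
Proof.
move=> xy /homogeneous_of_module[b hb] /homogeneous_of_module[c hc].
have : arc T x y = ~~ arc T y x by rewrite arcN.
rewrite hb 1?eq_sym // hc // => bc.
by apply: (good_source_sink xy hb) => v vy; rewrite arcN // hc // bc.
Qed.

(** The excluded sets are those whose being a co-module would violate the hypotheses of one of the
    criteria above. None of them separates [x] from [y], which is what makes them easy to exclude in
    [flip_pairs]. *)
Lemma good_comodules T M N x y t : comodule T M -> comodule T N ->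
  [disjoint M & N] -> t \notin M :|: N -> x \in M -> y \in N ->
  ~~ comodule T (M :|: N) -> ~~ comodule T (M :\ x) -> ~~ comodule T (N :\ y) ->
  ~~ comodule T (y |: M) -> ~~ comodule T (x |: N) -> good T x y.
Proof.
move=> cM cN dMN tMN xM yN nU nMx nNy nyM nxN.
have [tM tN] : t \notin M /\ t \notin N by apply/andP; move: tMN; rewrite inE negb_or.
have xN : x \notin N by rewrite (disjointFr dMN).
have yM : y \notin M by rewrite (disjointFl dMN).
have xy : x != y by apply: mem_neq xM yM.
have gU : 1 < #|M :|: N|.
  by apply/card_gt1P; exists x, y; split; rewrite ?inE ?xM ?yN ?orbT.
have nmU : ~~ is_module T (M :|: N).
  by apply: contra nU => mU; apply: module_comodule mU gU tMN.
have cm A B a b : [disjoint A & B] -> t \notin A -> t \notin B -> a \in A -> b \in B ->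
    ~~ comodule T (A :\ a) -> ~~ comodule T (b |: A) -> ~~ is_module T (A :|: B) ->
    is_module T (~: A) -> is_module T B -> 1 < #|B| -> good T a b.
  move=> dAB tA tB aA bB nAa nbA nAB mA mB gB.
  have aB : a \notin B by rewrite (disjointFr dAB).
  have bA : b \notin A by rewrite (disjointFl dAB).
  have [A1|A1] := eqVneq A [set a].
    move: mA nAB; rewrite A1 => /homogeneous_of_module[c hc] nAB.
    exact: (good_homogeneous hc mB gB aB bB nAB).
  have gC : 2 < #|~: A|.
    apply: (@leq_trans #|t |: B|); first by rewrite cardsU1 tB.
    apply: subset_leq_card; apply/subsetP => u; rewrite !inE.
    by case/orP => [/eqP->//|uB]; rewrite (disjointFl dAB).
  (* If [b] were extreme in the module [~: A], removing it would leave a module, and [b |: A] would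
     be a co-module. *)
  have ext c : exists2 q, q \in ~: A & (q != b) && (arc T b q == c).
    apply/exists_inP; apply: contraR nbA => /exists_inPn no.
    apply: (module_comoduleC (x := b)); last by rewrite !inE eqxx.
      have -> : ~: (b |: A) = ~: A :\ b by apply/setP=> u; rewrite !inE negb_or.
      apply: (module_setD1 (b := ~~ c) mA); first by rewrite inE.
      by move=> v vA vb; have := no v vA; rewrite vb /=; case: arc; case: (c).
    have -> : ~: (b |: A) = ~: A :\ b by apply/setP=> u; rewrite !inE negb_or.
    by move: gC; rewrite (cardsD1 b (~: A)) inE bA.
  have [q1 q1A /andP[q1b /eqP bq1]] := ext true.
  have [q2 q2A /andP[q2b /eqP bq2]] := ext false.
  apply: (@good_outside T (~: A) a b q1 q2) => //; rewrite ?inE ?aA //.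
    by rewrite arcN // bq2.
  apply: contra nAa => mU; have /subset_neq_ex[c cA ca] : ~~ (A \subset [set a]).
    by apply: contra A1 => s; rewrite eqEsubset s sub1set.
  apply: (module_comoduleC (x := c)); last by rewrite !inE cA andbT -in_set1.
    suff -> : ~: (A :\ a) = a |: ~: A by [].
    by apply/setP=> u; rewrite !inE negb_and negbK.
  suff -> : ~: (A :\ a) = a |: ~: A by rewrite cardsU1 inE aA add1n ltnS (ltn_trans _ gC).
  by apply/setP=> u; rewrite !inE negb_and negbK.
have dNM : [disjoint N & M] by rewrite disjoint_sym.
case/orP: cM => /nontrivialP[mM gM _]; case/orP: cN => /nontrivialP[mN gN _].
- exact: (good_modules mM mN).
- by apply: goodC; apply: (cm N M) => //; rewrite setUC.
- exact: (cm M N).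
have N0 : N != set0 by apply/set0Pn; exists y.
have M0 : M != set0 by apply/set0Pn; exists x.
(* Both complements are modules, so [M] and [N] are modules as well; only two singletons escape the
   previous cases. *)
have mM' := comodules_modules dMN tMN mM mN N0.
have mN' : is_module T N.
  by apply: (comodules_modules dNM _ mN mM M0); rewrite setUC; exact: tMN.
have single A a : a \in A -> ~~ (1 < #|A|) -> A = [set a].
  move=> aA; rewrite -leqNgt => sA; apply/eqP; rewrite eq_sym eqEcard sub1set aA.
  by rewrite cards1.
have [gN'|/(single N y yN) N1] := boolP (1 < #|N|); first exact: (cm M N).
have [gM'|/(single M x xM) M1] := boolP (1 < #|M|).
  by apply: goodC; apply: (cm N M) => //; rewrite setUC.
by apply: good_homogeneous2; rewrite // -?M1 -?N1.
Qed.

(** Each split makes one of its two pairs a module of the tournament on the four points. Three such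
    pairs, one per split, form a triangle or a star. A triangle would give three vertices each
    seeing the other two alike; at the centre of a star, any two of the three arcs would have
    opposite directions. The proof checks all cases. *)
Lemma three_splits T K C C' x1 y1 x2 y2 :
  comodule T K -> comodule T C -> comodule T C' ->
  [/\ x1 \in K, y1 \in K, x2 \notin K & y2 \notin K] ->
  ~~ separates C x1 x2 -> ~~ separates C y1 y2 -> separates C x1 y1 ->
  ~~ separates C' x1 y2 -> ~~ separates C' y1 x2 -> separates C' x1 y1 -> False.
Proof.
rewrite /separates !negbK.
have mod A : comodule T A -> exists c, forall u v w,
    [&& (u \in A) == c, (v \in A) == c & (w \in A) != c] ==>
      (arc T w u == arc T w v).
  case/orP => /andP[/moduleP m _]; [exists true|exists false] => u v w;
    apply/implyP => /and3P[hu hv hw]; apply/eqP; apply: m;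
    by rewrite ?inE ?(eqP hu) ?(eqP hv) //; case: (_ \in _) hw.
move=> /mod[k hk] /mod[c hc] /mod[c' hc'] [x1K y1K /negbTE x2K /negbTE y2K].
move=> /eqP e1 /eqP e2 e3 /eqP e4 /eqP e5 e6.
have E1 : (y1 \in C) = ~~ (x1 \in C) by move: e3; do 2!case: (_ \in _).
have E2 : (y1 \in C') = ~~ (x1 \in C') by move: e6; do 2!case: (_ \in _).
have [x1y1 x1x2] : x1 != y1 /\ x1 != x2.
  split; first by apply: contraNneq e3 => ->.
  by apply: contraFneq x2K => <-.
have x1y2 : x1 != y2 by apply: contraFneq y2K => <-.
have y1x2 : y1 != x2 by apply: contraFneq x2K => <-.
have y1y2 : y1 != y2 by apply: contraFneq y2K => <-.
have x2y2 : x2 != y2 by apply: contraNneq e3 => e; rewrite e1 e e2.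
have K1 := hk x1 y1 x2; have K2 := hk x1 y1 y2.
have K3 := hk x2 y2 x1; have K4 := hk x2 y2 y1.
have C1 := hc x1 x2 y1; have C2 := hc x1 x2 y2.
have C3 := hc y1 y2 x1; have C4 := hc y1 y2 x2.
have D1 := hc' x1 y2 y1; have D2 := hc' x1 y2 x2.
have D3 := hc' y1 x2 x1; have D4 := hc' y1 x2 y2.
move: K1 K2 K3 K4 C1 C2 C3 C4 D1 D2 D3 D4.
rewrite !(x1K, y1K, x2K, y2K, =^~ e1, =^~ e2, =^~ e4, =^~ e5, E1, E2).
rewrite [arc T y1 x1]arcN 1?eq_sym // [arc T x2 x1]arcN 1?eq_sym //.
rewrite [arc T y2 x1]arcN 1?eq_sym // [arc T x2 y1]arcN 1?eq_sym //.
rewrite [arc T y2 y1]arcN 1?eq_sym // [arc T y2 x2]arcN 1?eq_sym //.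
move: (arc T x1 y1) (arc T x1 x2) (arc T x1 y2) (arc T y1 x2) (arc T y1 y2) (arc T x2 y2).
move: (x1 \in C) (x1 \in C') k c c' {hk hc hc'} => p q k c c'.
by case: k; case: c; case: c'; case: p; case: q; do 6!case.
Qed.

End Flips.
(** * Representatives of the minimal co-modules *)

Section Representatives.
Variables (V : finType).
Implicit Types (T : tournament V) (M N K A B C Q R : {set V}) (x y u v w : V).

Definition outdeg T x := #|[set y | arc T x y]|.

Lemma twin_outdeg T M a b : is_module T M -> #|M| = 2 -> a \in M -> b \in M ->
  arc T a b -> outdeg T b < outdeg T a.
Proof.
move=> mM M2 aM bM ab; apply: proper_card; apply/properP; split; last first.
  by exists b; rewrite inE ?ab ?arcxx.
apply/subsetP => v; rewrite !inE => bv.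
have [vM|vM] := boolP (v \in M); last by rewrite (module_out mM aM bM vM).
have nab := arc_neq ab.
have eM : M = [set a; b].
  by apply/eqP; rewrite eq_sym eqEcard subUset !sub1set aM bM cards2 nab M2.
move: vM; rewrite eM !inE => /orP[] /eqP ev; last by move: bv; rewrite ev arcxx.
by move: bv; rewrite ev arcN 1?eq_sym // ab.
Qed.

Lemma card2_other M r : #|M| = 2 -> r \in M ->
  exists a, [/\ a \in M, a != r & M = [set a; r]].
Proof.
move=> M2 rM; have [a aM ar] : exists2 a, a \in M & a != r.
  by apply: card_gt1_ex; rewrite M2.
exists a; split=> //.
by apply/eqP; rewrite eq_sym eqEcard subUset !sub1set aM rM cards2 ar M2.
Qed.

Definition sink_rep T M r :=
  r \in M /\ (#|M| = 2 -> forall a, a \in M -> a != r -> arc T a r).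

Lemma sink_rep_exists T M : M != set0 -> exists r, sink_rep T M r.
Proof.
case/set0Pn => r rM; have [M2|M2] := eqVneq #|M| 2; last first.
  by exists r; split=> // /eqP; rewrite (negbTE M2).
have [a [aM ar eM]] := card2_other M2 rM.
have [har|har] := boolP (arc T a r).
  exists r; split=> // _ u; rewrite eM !inE => /orP[] /eqP-> //.
  by rewrite eqxx.
exists a; split=> // _ u; rewrite eM !inE => /orP[] /eqP-> //.
  by rewrite eqxx.
by rewrite arcN // eq_sym.
Qed.

(* Distinct overlapping minimal co-modules are consecutive pairs of a chain of
   twins; the one starting earlier in the chain has the larger sum of
   out-degrees, so its sink belongs to the other. *)
Lemma sink_rep_overlap T M K r z : mincom T M -> mincom T K -> M != K ->
  z \in M -> z \in K -> sink_rep T M r ->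
  \sum_(x in K) outdeg T x <= \sum_(x in M) outdeg T x -> r \in K.
Proof.
move=> mM mK nMK zM zK [rM rsink] le.
have [M2 K2 modM modK] := mincom_overlap mM mK nMK zM zK.
have [a [aM ar eM]] := card2_other M2 rM.
have [//|rK] := boolP (r \in K).
have za : z = a.
  by move: zM; rewrite eM !inE => /orP[] /eqP // zr; rewrite -zr zK in rK.
rewrite {z zM}za in zK.
have [c [cK ca eK]] := card2_other K2 zK.
have hr := rsink M2 a aM ar.
have cM : c \notin M.
  rewrite eM !inE negb_or ca /=; apply: contraNneq rK => <-; exact: cK.
have cr : c != r by apply: contraNneq rK => <-.
have hc : arc T c r by rewrite (module_out modK cK zK rK).
have hca : arc T c a by rewrite (module_in modM aM rM cM).
have := twin_outdeg modM M2 aM rM hr.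
have := twin_outdeg modK K2 cK zK hca.
move: le; rewrite eK eM !(big_setU1, big_set1) ?inE //= => le h1 h2.
by move: le; rewrite addnC leq_add2l leqNgt (ltn_trans h2 h1).
Qed.

(** The choice is greedy: the sink representative of a member with the largest sum of out-degrees
    lies in every member meeting it. The members that avoid this representative are thus disjoint
    from the chosen one, and the induction handles them. *)
Lemma representatives_sub T (F : {set {set V}}) :
  (forall M, M \in F -> mincom T M) ->
  exists R (f : V -> {set V}),
    [/\ forall r, r \in R -> f r \in F /\ sink_rep T (f r) r,
        forall r r', r \in R -> r' \in R -> r != r' -> [disjoint f r & f r'] &
        forall M, M \in F -> exists2 r, r \in R & r \in M].
Proof.
move: {2}#|F| (leqnn #|F|) => n; elim: n F => [|n IHn] F.
  rewrite leqn0 cards_eq0 => /eqP-> _; exists set0, (fun=> set0).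
  by split=> [r|r r'|M]; rewrite !inE.
move=> leF mF; have [F0|/set0Pn[M0 M0F]] := eqVneq F set0.
  by apply: IHn; rewrite ?F0 ?cards0 // => M; rewrite inE.
case: (arg_maxnP (fun M : {set V} => \sum_(x in M) outdeg T x) M0F) => M MF maxM.
have mM := mF M MF.
have /(sink_rep_exists T)[r rM] : M != set0.
  by have /mincom_comodule/comodule_neq0[z zM] := mM; apply/set0Pn; exists z.
pose F' := [set K in F | r \notin K].
have [|K|R [f [fR dR hR]]] := IHn F'.
- have : F' \proper F.
    apply/properP; split; first by apply/subsetP => K; rewrite inE => /andP[].
    by exists M; rewrite ?inE // negb_and negbK rM.1 orbT.
  by move/proper_card => lt; rewrite -ltnS (leq_trans lt).
- by rewrite inE => /andP[/mF].
have dM K : K \in F' -> [disjoint M & K].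
  rewrite inE => /andP[KF rK]; apply/pred0P => z /=; apply/negP => /andP[zM zK].
  have nMK : M != K by apply: contraNneq rK => <-; exact: rM.1.
  by move: rK; rewrite (sink_rep_overlap mM (mF K KF) nMK zM zK rM) //; exact: maxM.
have rR : r \notin R.
  apply/negP => /fR[]; rewrite inE => /andP[_ nr] [].
  by rewrite (negbTE nr).
pose g v := if v == r then M else f v.
have gr : g r = M by rewrite /g eqxx.
have gR v : v \in R -> g v = f v.
  by move=> vR; rewrite /g; case: eqP => // e; rewrite -e vR in rR.
exists (r |: R), g; split=> [v|v v'|K KF].
- rewrite !inE => /orP[/eqP->|vR]; first by rewrite gr.
  by rewrite gR //; have [] := fR v vR; rewrite inE => /andP[].
- rewrite !inE => /orP[/eqP->|vR] /orP[/eqP->|v'R]; rewrite ?eqxx // ?gr => nv.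
  + by rewrite gR //; apply: dM; have [] := fR v' v'R.
  + by rewrite gR // disjoint_sym; apply: dM; have [] := fR v vR.
  + by rewrite !gR //; apply: dR.
have [rK|rK] := boolP (r \in K); first by exists r; rewrite // !inE eqxx.
have [|v vR vK] := hR K; first by rewrite inE KF.
by exists v; rewrite // !inE vR orbT.
Qed.

Definition hitting T R := forall C, comodule T C -> exists2 r, r \in R & r \in C.

Definition representatives T R (f : V -> {set V}) :=
  [/\ forall r, r \in R -> mincom T (f r) /\ sink_rep T (f r) r,
      forall r r', r \in R -> r' \in R -> r != r' -> [disjoint f r & f r'] &
      hitting T R].

Lemma representatives_exist T : exists R f, representatives T R f.
Proof.
have [|R [f [fR dR hR]]] := @representatives_sub T [set M | mincom T M].
  by move=> M; rewrite inE.
exists R, f; split=> // [r rR|C].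
  by have [] := fR r rR; rewrite inE.
case/mincom_exists => M mM sM; have [|r rR rM] := hR M; first by rewrite inE.
by exists r => //; apply: (subsetP sM).
Qed.

Lemma Delta_hitting T R : hitting T R -> Delta T <= #|R|.
Proof.
move=> hR; apply/bigmax_leqP => D /andP[tD /forall_inP cD].
pose g (C : {set V}) := [pick r in R | r \in C].
have gP C : C \in D -> exists r, [/\ g C = Some r, r \in R & r \in C].
  move=> CD; rewrite /g; case: pickP => [r /andP[rR rC]|no]; first by exists r.
  by have [r rR rC] := hR C (cD C CD); have := no r; rewrite rR rC.
have injg : {in D &, injective g}.
  move=> A B AD BD e; have [r [gA _ rA]] := gP A AD.
  have [r' [gB _ rB]] := gP B BD; apply/eqP; apply: contraT => nAB.
  have := trivIsetP tD A B AD BD nAB => /pred0P/(_ r) /=; rewrite rA.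
  by move: gB; rewrite -e gA => -[->]; rewrite rB.
rewrite -(card_in_imset injg) -(card_imset R Some_inj) subset_leq_card //.
apply/subsetP => _ /imsetP[C CD ->]; have [r [-> rR _]] := gP C CD.
by apply/imsetP; exists r.
Qed.

(** Together with [Delta_hitting], this makes [#|R|] equal to [Delta T]. *)
Lemma Delta_representatives T R f : representatives T R f -> #|R| <= Delta T.
Proof.
case=> fR dR _; rewrite /Delta.
have injf : {in R &, injective f}.
  move=> r r' rR r'R e; apply/eqP; apply: contraT => rr'.
  have := dR r r' rR r'R rr'; rewrite e => /pred0P/(_ r') /=.
  by have [_ [->]] := fR r' r'R.
rewrite -(card_in_imset injf); apply: (bigmax_sup (f @: R)) => //.
apply/andP; split; last first.
  apply/forall_inP => M /imsetP[r rR ->].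
  by have [/mincom_comodule] := fR r rR.
apply/trivIsetP => M N /imsetP[r rR ->] /imsetP[r' r'R ->] nMN.
by apply: dR => //; apply: contraNneq nMN => ->.
Qed.

End Representatives.
(** * Reversing a matching on the representatives *)

Section Pairing.
Variables (V : finType).
Implicit Types (T S : tournament V) (M N K A B C Q R : {set V}) (x y u v w : V).
Implicit Types (ps : seq (V * V)).

Definition ends ps := flatten [seq [:: p.1; p.2] | p <- ps].

Definition unseparated T ps :=
  [set K | comodule T K & all (fun p => ~~ separates K p.1 p.2) ps].

Lemma mem_ends ps p : p \in ps -> p.1 \in ends ps /\ p.2 \in ends ps.
Proof.
by move=> pps; split; apply/flatten_mapP; exists p; rewrite // !inE eqxx ?orbT.
Qed.

Lemma ends_mem ps r : r \in ends ps ->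
  exists2 p, p \in ps & r = p.1 \/ r = p.2.
Proof.
case/flatten_mapP => p pps; rewrite !inE => /orP[] /eqP->; exists p; auto.
Qed.

Lemma perm_ends ps qs : perm_eq ps qs -> perm_eq (ends ps) (ends qs).
Proof. by move=> e; apply: perm_flatten; apply: perm_map. Qed.

Lemma uniq_ends_neq ps p : uniq (ends ps) -> p \in ps -> p.1 != p.2.
Proof.
elim: ps => //= q ps IH; rewrite inE negb_or -!andbA => /and4P[q12 _ _ uq].
by rewrite inE => /orP[/eqP->|/(IH uq)].
Qed.

Lemma size_ends ps : size (ends ps) = (size ps).*2.
Proof. by elim: ps => //= p ps IH; rewrite IH doubleS. Qed.

(* A co-module [K] separating no pair contains a pair and avoids another one.
   Both ways of exchanging the ends of these two pairs separate [K], and by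
   [three_splits] one of them leaves no further co-module unseparated. *)
Lemma pairing T ps : (forall C, comodule T C -> exists2 r, r \in ends ps & r \in C) ->
  exists2 qs, perm_eq (ends qs) (ends ps) & unseparated T qs = set0.
Proof.
move: {2}#|unseparated T ps| (leqnn #|unseparated T ps|) => n.
elim: n ps => [|n IHn] ps.
  by rewrite leqn0 cards_eq0 => /eqP e _; exists ps.
move=> len hit; have [e|/set0Pn[K]] := eqVneq (unseparated T ps) set0.
  by exists ps.
rewrite inE => /andP[cK /allP nK].
have pairK A : comodule T A -> (forall p, p \in ps -> ~~ separates A p.1 p.2) ->
    exists2 p, p \in ps & (p.1 \in A) && (p.2 \in A).
  move=> cA nA; have [r /ends_mem[p pps rp] rA] := hit A cA; exists p => //.
  have := nA p pps; rewrite negbK => /eqP e.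
  by case: rp => e'; rewrite e' in rA; rewrite ?e ?rA // -e rA.
have [[x1 y1] p1 /= /andP[x1K y1K]] := pairK K cK nK.
have [||[x2 y2] p2 /=] := pairK (~: K); first by rewrite comoduleC.
  by move=> p /nK; rewrite separates_setC.
rewrite !inE => /andP[x2K y2K].
have [rest permps] : exists rest, perm_eq ps [:: (x1, y1), (x2, y2) & rest].
  have e1 := perm_to_rem p1; exists (rem (x2, y2) (rem (x1, y1) ps)).
  apply: (perm_trans e1); rewrite perm_cons; apply: perm_to_rem.
  move: p2; rewrite (perm_mem e1) inE => /orP[/eqP[e _]|//].
  by rewrite e x1K in x2K.
have eU : unseparated T ps = unseparated T [:: (x1, y1), (x2, y2) & rest].
  by apply/setP => C; rewrite !inE (perm_all _ permps).
have step qs : perm_eq (ends qs) (ends [:: (x1, y1), (x2, y2) & rest]) ->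
    K \notin unseparated T qs -> unseparated T qs \subset unseparated T ps ->
    exists2 qs', perm_eq (ends qs') (ends ps) & unseparated T qs' = set0.
  move=> pe KU sU; have pe' : perm_eq (ends qs) (ends ps).
    by apply: (perm_trans pe); rewrite perm_sym perm_ends.
  have [||qs' pq uq] := IHn qs.
  - rewrite -ltnS; apply: leq_trans len; apply: proper_card.
    apply/properP; split=> //; exists K => //; rewrite inE cK; exact/allP.
  - by move=> C /hit[r rps rC]; exists r; rewrite // (perm_mem pe').
  by exists qs' => //; apply: perm_trans pe'.
pose qs1 := [:: (x1, x2), (y1, y2) & rest].
pose qs2 := [:: (x1, y2), (y1, x2) & rest].
have [sub1|/subset_neq_ex[/= C C1 C2]] :=
  boolP (unseparated T qs1 \subset unseparated T ps).
  apply: (step qs1) => //; last by rewrite inE /= /separates x1K (negbTE x2K) andbF.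
  by apply/permP => P /=; rewrite (addnCA (P x2)).
have [sub2|/subset_neq_ex[/= C' C'1 C'2]] :=
  boolP (unseparated T qs2 \subset unseparated T ps).
  apply: (step qs2) => //; last by rewrite inE /= /separates x1K (negbTE y2K) andbF.
  apply/permP => P /=; congr (_ + _).
  by rewrite (addnCA (P y2)) (addnCA (P y2)) (addnCA (P y1)).
(* [C] and [C'] separate an old pair but none of their new pairs, hence both old pairs. With [K]
   they split the four ends in all three ways. *)
exfalso; move: C1 C2 C'1 C'2; rewrite eU !inE /=.
move=> /andP[cC /and3P[a1 a2 ->]]; rewrite cC andbT /= => b1.
move=> /andP[cC' /and3P[a1' a2' ->]]; rewrite cC' andbT /= => b1'.
apply: (three_splits cK cC cC' _ a1 a2 _ a1' a2' _); first by split.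
  move: b1; move: a1 a2; rewrite /separates !negbK => /eqP-> /eqP->.
  by rewrite eq_sym andbb.
move: b1'; move: a1' a2'; rewrite /separates !negbK => /eqP-> /eqP->.
by rewrite andbC [(y2 \in _) == _]eq_sym andbb.
Qed.

(** Distance to the indecomposable tournaments. Compared with a set [B] of reversed arcs, this form
    lets single flips accumulate without recording which arcs they reverse. *)
Definition near T m :=
  exists2 S, indecomposable S & #|arcs T :\: arcs S| <= m.

Lemma near_flip T x y m : x != y -> near (flip T x y) m -> near T m.+1.
Proof.
move=> xy [S iS le]; exists S => //.
have sub : arcs T :\: arcs S \subset
    (if arc T x y then (x, y) else (y, x)) |: (arcs (flip T x y) :\: arcs S).
  apply/subsetP => -[u v]; rewrite in_setD in_setU1 in_setD => /andP[-> uv].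
  have := arc_flip T u v xy; rewrite {1 2}/arc uv => ->.
  case E: ((u == x) && _ || _); rewrite ?orbT // orbF.
  case/orP: E => /andP[/eqP eu /eqP ev].
    by rewrite -eu -ev /arc uv eqxx.
  have : arc T y x by rewrite -eu -ev.
  by rewrite arcN 1?eq_sym // => /negbTE ->; rewrite eu ev.
apply: leq_trans (subset_leq_card sub) _.
by rewrite cardsU1 -add1n leq_add // leq_b1.
Qed.

Lemma near0 T : (forall C, ~~ comodule T C) -> near T 0.
Proof. by move/indecomposableP; exists T => //; rewrite setDv cards0. Qed.

Lemma near_le T m n : m <= n -> near T m -> near T n.
Proof. by move=> mn [S iS le]; exists S => //; apply: leq_trans mn. Qed.

(** All hypotheses survive the flip of the first pair: the sets of the other ends avoid [x] and [y]
    and stay co-modules, and a co-module of the flipped tournament is an old one not separating [x]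
    from [y], so a later pair separates it. *)
Lemma flip_pairs T ps (f : V -> {set V}) : uniq (ends ps) ->
  (forall r, r \in ends ps -> comodule T (f r) /\ r \in f r) ->
  (forall r r', r \in ends ps -> r' \in ends ps -> r != r' ->
     [disjoint f r & f r']) ->
  (forall p, p \in ps -> exists t, t \notin f p.1 :|: f p.2) ->
  (forall C, comodule T C -> has (fun p => separates C p.1 p.2) ps) ->
  near T (size ps).
Proof.
elim: ps T => [|[x y] ps IHps] T.
  by move=> _ _ _ _ H; apply: near0 => C; apply/negP => /H.
rewrite /= -/(ends ps) inE negb_or -andbA => /and4P[xy xps yps ups].
move=> cf df tf sf.
have xE : x \in [:: x, y & ends ps] by rewrite inE eqxx.
have yE : y \in [:: x, y & ends ps] by rewrite !inE eqxx orbT.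
have rE r : r \in ends ps -> r \in [:: x, y & ends ps].
  by rewrite !inE => ->; rewrite !orbT.
have [cx xfx] := cf x xE; have [cy yfy] := cf y yE.
have [t /= tU] := tf (x, y) (mem_head _ _).
have out r : r \in ends ps -> r \notin f x :|: f y.
  move=> rps; have [_ rfr] := cf r (rE r rps); rewrite inE negb_or.
  have rx : r != x by apply: contraNneq xps => <-.
  have ry : r != y by apply: contraNneq yps => <-.
  by rewrite !(disjointFr (df r _ _ _ _) rfr) // rE.
(* All later ends lie outside [f x :|: f y], so no later pair separates a subset of it. *)
have nco A : A \subset f x :|: f y -> ~~ separates A x y -> ~~ comodule T A.
  move=> sA nA; apply/negP => /sf /=; rewrite (negbTE nA) /=.
  case/hasP => p /mem_ends[/out p1 /out p2].
  rewrite /separates; have nA' r : r \notin f x :|: f y -> (r \in A) = false.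
    by move=> rU; apply: contraNF rU => /(subsetP sA).
  by rewrite !nA'.
have dxy := df x y xE yE xy.
have xfy : (x \in f y) = false by rewrite (disjointFr dxy).
have yfx : (y \in f x) = false by rewrite (disjointFl dxy).
have g : good T x y.
  apply: (good_comodules cx cy dxy tU xfx yfy); apply: nco;
    rewrite /separates ?inE ?eqxx ?xfx ?yfy ?xfy ?yfx ?orbT //=.
  - by apply: subset_trans (subD1set _ _) (subsetUl _ _).
  - by rewrite andbF.
  - by apply: subset_trans (subD1set _ _) (subsetUr _ _).
  - by rewrite andbF.
  - by rewrite subUset sub1set subsetUl inE yfy orbT.
  - by rewrite subUset sub1set subsetUr inE xfx.
apply: (near_flip xy); apply: IHps => // [r rps|r r' rps r'ps|p pps|C cC].
- have [cr rr] := cf r (rE r rps); split=> //; rewrite comodule_flip //.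
  have rx : r != x by apply: contraNneq xps => <-.
  have ry : r != y by apply: contraNneq yps => <-.
  rewrite /separates (disjointFl (df r x (rE r rps) xE rx) xfx).
  by rewrite (disjointFl (df r y (rE r rps) yE ry) yfy).
- by apply: df; apply: rE.
- by apply: tf; rewrite inE pps orbT.
have [/sf /= sC /negbTE nC] := good_comodule xy g cC.
by rewrite nC in sC.
Qed.

Lemma near_representatives_even T R (f : V -> {set V}) :
  representatives T R f -> ~~ odd #|R| ->
  (forall r r', r \in R -> r' \in R -> r != r' -> exists t, t \notin f r :|: f r') ->
  near T #|R|./2.
Proof.
move=> [fR dR hR] evR tR.
have [ps0 eps0] : exists ps0, ends ps0 = enum R.
  have : ~~ odd (size (enum R)) by rewrite -cardE.
  move: {2}(size _) (leqnn (size (enum R))) => n.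
  elim: n (enum R) => [|n IHn] [|a [|b s]] //= le ev; try by exists [::].
  rewrite negbK in ev; have [|ps <-] := IHn s _ ev; first exact: ltnW.
  by exists ((a, b) :: ps).
have [|ps pe us] := @pairing T ps0.
  by move=> C /hR[r rR rC]; exists r; rewrite // eps0 mem_enum.
have inR r : (r \in ends ps) = (r \in R) by rewrite (perm_mem pe) eps0 mem_enum.
have uniqps : uniq (ends ps) by rewrite (perm_uniq pe) eps0 enum_uniq.
have szps : size ps = #|R|./2.
  by rewrite cardE -eps0 -(perm_size pe) size_ends doubleK.
rewrite -szps; apply: (@flip_pairs T ps f uniqps) => [r|r r'|p pps|C cC].
- by rewrite inR => /fR[/mincom_comodule ? []].
- by rewrite !inR; apply: dR.
- have [p1 p2] := mem_ends pps; apply: tR; rewrite -?inR //.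
  exact: uniq_ends_neq pps.
have : C \notin unseparated T ps by rewrite us inE.
rewrite inE cC /= -has_predC => /hasP[p pps /=]; rewrite negbK => s.
by apply/hasP; exists p.
Qed.

End Pairing.
(** * Lowering an odd number of representatives *)

Section OddStep.
Variables (V : finType).
Implicit Types (T : tournament V) (M N K A B C Q R : {set V}) (x y u v w : V).

Definition reducible T R := exists x y R',
  [/\ x != y, good T x y, hitting (flip T x y) R' & #|R'| < #|R|].

Lemma reducible_reps T R x y : hitting T R -> x \in R -> y \in R -> x != y ->
  good T x y -> reducible T R.
Proof.
move=> hR xR yR xy g; exists x, y, (R :\ x); split=> //; last first.
  by rewrite [in X in _ < X](cardsD1 x R) xR.
move=> C /(good_comodule xy g)[/hR[r rR rC]]; rewrite negbK => /eqP e.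
have [er|rx] := eqVneq r x; last by exists r; rewrite // !inE rx.
by exists y; rewrite ?inE ?yR 1?eq_sym ?xy // -e -er.
Qed.

Lemma mincom_nonextreme T M r b : mincom T M -> is_module T M -> 2 < #|M| ->
  r \in M -> exists2 v, v \in M & (v != r) && (arc T r v == b).
Proof.
move=> mM modM gM rM; apply/exists_inP; apply: contraT => /exists_inPn no.
have mD : is_module T (M :\ r).
  apply: (module_setD1 (b := ~~ b) modM rM) => v vM vr.
  by have := no v vM; rewrite vr /=; case: arc; case: (b).
have := mincom_small mM (subD1set M r) rM; rewrite !inE eqxx => /(_ isT mD).
by move: gM; rewrite (cardsD1 r M) rM add1n ltnS ltnNge => /negbTE->.
Qed.

(** In a two-element module no vertex has both an in- and an out-neighbour. Taking the sink secures
    at least the in-neighbour that [good_nonextreme] needs at the head of an arc. *)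
Lemma rep_nonsource T M r : mincom T M -> is_module T M -> 1 < #|M| ->
  sink_rep T M r -> exists2 v, v \in M & arc T v r.
Proof.
move=> mM modM gM [rM sM]; have [M2|M2] := eqVneq #|M| 2.
  have [a [aM ar _]] := card2_other M2 rM; exists a => //; exact: sM.
have g2 : 2 < #|M| by rewrite ltn_neqAle eq_sym M2.
have [v vM /andP[vr /eqP e]] := mincom_nonextreme false mM modM g2 rM.
by exists v => //; rewrite arcN // e.
Qed.

Lemma set2_module_overlap T M L r a : mincom T M -> mincom T L -> r \in M ->
  r \in L -> a \in M -> a \notin L -> arc T a r ->
  exists c, [/\ c != r, arc T r c & is_module T [set r; c]].
Proof.
move=> mM mL rM rL aM aL ar.
have nML : M != L by apply: contraNneq aL => <-.
have [M2 L2 modM modL] := mincom_overlap mM mL nML rM rL.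
have [c [cL cr eL]] := card2_other L2 rL; exists c; rewrite setUC -eL; split=> //.
have eM : M = [set a; r].
  by apply/eqP; rewrite eq_sym eqEcard subUset !sub1set aM rM cards2 (arc_neq ar) M2.
have ca : c != a by apply: contraNneq aL => <-.
have cM : c \notin M by rewrite eM !inE negb_or ca cr.
have ac : arc T a c by rewrite (module_in modL cL rL aL).
by rewrite (module_out modM rM aM cM).
Qed.

(* The exceptional [c] means that [f r] and [f r'] are consecutive pairs of twins,
   so that no third representative distinguishes [r] from [r']; three of them
   cannot be pairwise in this position. *)
Lemma reducible_modules T R f r r' : representatives T R f ->
  r \in R -> r' \in R -> r != r' ->
  nontrivial_module T (f r) -> nontrivial_module T (f r') -> arc T r r' ->
  reducible T R \/
  exists c, [/\ c \in f r', arc T r c & is_module T [set r; c]].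
Proof.
move=> [fR dR hR] rR r'R rr' /nontrivialP[modM gM _] /nontrivialP[modN gN _] arr'.
have [mM sM] := fR r rR; have [mN sN] := fR r' r'R; have rM := sM.1.
have r'N := sN.1; have dMN := dR r r' rR r'R rr'.
have [n nN nr'] := rep_nonsource mN modN gN sN.
have nnr' := arc_neq nr'.
have [M2|M2] := eqVneq #|f r| 2; last first.
  have g2 : 2 < #|f r| by rewrite ltn_neqAle eq_sym M2.
  have [v vM /andP[vr /eqP e]] := mincom_nonextreme true mM modM g2 rM.
  left; apply: (reducible_reps hR rR r'R rr').
  by apply: (good_nonextreme modM modN dMN rM r'N vM nN); rewrite ?arr' // e.
have [a [aM ar eM]] := card2_other M2 rM.
have har := sM.2 M2 a aM ar.
have [/existsP[c /and3P[cr rc modc]]|/existsPn no] :=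
    boolP [exists c, [&& c != r, arc T r c & is_module T [set r; c]]].
  have [cN|cN] := boolP (c \in f r'); first by right; exists c.
  left; apply: (reducible_reps hR rR r'R rr').
  apply: (@good_nonextreme V T [set r; c] (f r') r r' c n);
    rewrite ?inE ?eqxx ?orbT ?arr' //.
  apply/pred0P => z /=; rewrite !inE.
  case: eqP => [->|_] /=; first by rewrite (disjointFr dMN).
  by case: eqP => [->|] //=; rewrite (negbTE cN).
left; exists a, r', (R :\ r).
have aN : a \notin f r' by rewrite (disjointFr dMN).
have ar' : a != r' by rewrite eq_sym (mem_neq r'N aN).
have harr' : arc T a r' by rewrite (modules_arc modM modN dMN aM rM r'N r'N).
have g : good T a r'.
  by apply: (good_nonextreme modM modN dMN aM r'N rM nN);
    rewrite ?harr' 1?eq_sym // eq_sym.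
split=> //; last by rewrite [in X in _ < X](cardsD1 r R) rR.
move=> C /(good_comodule ar' g)[cC]; rewrite negbK => /eqP e.
have [L mL sL] := mincom_exists cC.
have [s sR sLs] := hR L (mincom_comodule mL).
have [es|sr] := eqVneq s r; last first.
  by exists s; rewrite ?inE ?sr //; apply: (subsetP sL).
have [r'C|r'C] := boolP (r' \in C).
  by exists r'; rewrite // !inE eq_sym rr'.
rewrite es in sLs; have aL : a \notin L.
  by apply: contra r'C => aL; rewrite -e (subsetP sL).
have [c [cr rc mc]] := set2_module_overlap mM mL rM sLs aM aL har.
by have := no c; rewrite cr rc mc.
Qed.

Lemma reducible_odd T R f : representatives T R f -> 2 < #|R| -> reducible T R.
Proof.
move=> repR gR; have [fR dR hR] := repR.
pose Rm := [set r in R | nontrivial_module T (f r)].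
have sRm : Rm \subset R by apply/subsetP => r; rewrite inE => /andP[].
have notin r s : r \in R -> s \in R -> s != r -> s \notin f r.
  move=> rR sR sr; rewrite (disjointFr (dR s r sR rR sr)) //.
  by have [_ []] := fR s sR.
have RmP r : r \in Rm -> r \in R /\ nontrivial_module T (f r).
  by rewrite inE => /andP.
have symm r r' : r \in Rm -> r' \in Rm -> r != r' -> reducible T R \/
    forall s, s \in R -> s != r -> s != r' -> arc T s r = arc T s r'.
  have one p q : p \in Rm -> q \in Rm -> p != q -> arc T p q -> reducible T R \/
      forall s, s \in R -> s != p -> s != q -> arc T s p = arc T s q.
    move=> /RmP[pR mp] /RmP[qR mq] pq apq.
    have [|[c [cq pc mc]]] := reducible_modules repR pR qR pq mp mq apq.
      by left.
    right=> s sR sp sq; have sfq := notin q s qR sR sq.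
    rewrite (module_in mc (x := p) (y := c)) ?inE ?eqxx ?orbT //.
      by apply: (module_in (nontrivial_module_module mq)) => //; have [_ []] := fR q qR.
    by rewrite negb_or sp eq_sym (mem_neq cq sfq).
  move=> rm r'm rr'; have [a|a] := boolP (arc T r r'); first exact: one.
  rewrite eq_sym in rr'; have [||h] := one r' r r'm rm rr'; first by rewrite arcN.
    by left.
  by right=> s sR sr sr'; rewrite h.
have [gRm|leRm] := ltnP 2 #|Rm|.
  have /card_gt2P[r1 [r2 [r3 [[m1 m2 m3] [n12 n23 n31]]]]] := gRm.
  have n21 : r2 != r1 by rewrite eq_sym.
  have n32 : r3 != r2 by rewrite eq_sym.
  have n13 : r1 != r3 by rewrite eq_sym.
  have [[R1 _] [R2 _]] := (RmP _ m1, RmP _ m2); have [R3 _] := RmP _ m3.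
  have [//|h12] := symm r1 r2 m1 m2 n12.
  have [//|h23] := symm r2 r3 m2 m3 n23.
  have [//|h31] := symm r3 r1 m3 m1 n31.
  (* No tournament on three vertices lets each vertex see the other two alike. *)
  have := h12 r3 R3 n31 n32; have := h23 r1 R1 n12 n13; have := h31 r2 R2 n23 n21.
  rewrite [arc T r3 r2]arcN // [arc T r3 r1]arcN // [arc T r2 r1]arcN //.
  by do 3!case: arc.
have /subset_neq_ex[r0 r0R r0m] : ~~ (R \subset Rm).
  by apply: contraL leRm => /subset_leq_card le; rewrite -ltnNge (leq_trans gR).
have co r : r \in R -> r \notin Rm -> nontrivial_module T (~: f r).
  move=> rR; rewrite inE rR /= => nm.
  by have [/mincom_comodule/orP[|//]] := fR r rR; rewrite (negbTE nm).
have single r : r \in R -> r \notin Rm -> is_module T (f r) -> f r = [set r].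
  move=> rR; rewrite inE rR /= => nm mr; have [mc [rr _]] := fR r rR.
  apply/eqP; rewrite eq_sym eqEcard sub1set rr cards1 leqNgt.
  apply: contra nm => gr; apply/nontrivialP; split=> //.
  exact: comodule_compl (mincom_comodule mc).
have [/existsP[r1 /and3P[r1R r1m n10]]|/existsPn no] :=
    boolP [exists r1, [&& r1 \in R, r1 \notin Rm & r1 != r0]].
  (* A third representative lies outside both sets, so they are modules; not being nontrivial
     modules, they are singletons, and [r0] and [r1] are a source and a sink. *)
  have [r2 r2R] : exists2 r2, r2 \in R & r2 \notin [set r0; r1].
    apply: subset_neq_ex; apply: contraL gR => /subset_leq_card le.
    by rewrite -leqNgt (leq_trans le) // cards2; case: (_ != _).
  rewrite !inE negb_or => /andP[n20 n21].
  have n01 : r0 != r1 by rewrite eq_sym.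
  have d01 := dR r0 r1 r0R r1R n01.
  have [/nontrivialP[c0 _ _] /nontrivialP[c1 _ _]] := (co r0 r0R r0m, co r1 r1R r1m).
  have nonempty r : r \in R -> f r != set0.
    by move=> rR; apply/set0Pn; exists r; have [_ []] := fR r rR.
  have out : r2 \notin f r0 :|: f r1 by rewrite inE negb_or !notin.
  have m0 := comodules_modules d01 out c0 c1 (nonempty r1 r1R).
  have m1 : is_module T (f r1).
    rewrite disjoint_sym in d01; rewrite setUC in out.
    exact: comodules_modules d01 out c1 c0 (nonempty r0 r0R).
  apply: (reducible_reps hR r0R r1R n01); apply: good_homogeneous2 => //.
    by rewrite -(single r0).
  by rewrite -(single r1).
have Rm1 : 1 < #|Rm|.
  have : R :\ r0 \subset Rm.
    apply/subsetP => r; rewrite !inE => /andP[rr0 rR].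
    by have := no r; rewrite rR rr0 andbT /= negbK inE rR.
  move/subset_leq_card; apply: leq_trans.
  by move: gR; rewrite (cardsD1 r0 R) r0R.
have {Rm1} [r1 [r2 [m1 m2 n12 a12]]] : exists r1 r2,
    [/\ r1 \in Rm, r2 \in Rm, r1 != r2 & arc T r1 r2].
  have /card_gt1P[r1 [r2 [m1 m2 n12]]] := Rm1.
  have [a|a] := boolP (arc T r1 r2); first by exists r1, r2.
  by exists r2, r1; split; rewrite // 1?eq_sym // arcN // eq_sym.
have [[R1 mod1] [R2 mod2]] := (RmP _ m1, RmP _ m2).
have [//|[c [c2 r1c modc]]] := reducible_modules repR R1 R2 n12 mod1 mod2 a12.
have n10 : r1 != r0 by apply: contraNneq r0m => <-.
have n20 : r2 != r0 by apply: contraNneq r0m => <-.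
have n01 : r0 != r1 by rewrite eq_sym.
have n02 : r0 != r2 by rewrite eq_sym.
have n21 : r2 != r1 by rewrite eq_sym.
have /nontrivialP[c0 _ _] := co r0 r0R r0m.
have [mc0 [r0f0 _]] := fR r0 r0R.
have [rep1 rep2] : r1 \in f r1 /\ r2 \in f r2.
  by have [_ [? _]] := fR r1 R1; have [_ [? _]] := fR r2 R2.
(* A source [r0] is paired with [r2], a sink with [r1]; the remaining one of [r1], [r2] shows that
   adding [r0] to the partner's set does not give a module. *)
have [e0|ne0] := eqVneq (f r0) [set r0].
  have c0' := c0; rewrite e0 in c0'.
  have [b hb] := homogeneous_of_module c0'.
  have /nontrivialP[md1 g1 _] := mod1; have /nontrivialP[md2 g2 _] := mod2.
  case: b hb => hb.
    apply: (reducible_reps hR r0R R2 n02).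
    apply: (good_homogeneous hb md2 g2 _ rep2); first exact: notin.
    apply/negP => mU.
    have := module_in mU (x := r0) (y := r2) (v := r1).
    rewrite !inE eqxx rep2 orbT negb_or n10 notin // => /(_ isT isT isT).
    by rewrite a12 arcN // hb.
  apply: (reducible_reps hR r0R R1 n01).
  apply: (good_homogeneous hb md1 g1 _ rep1); first exact: notin.
  apply/negP => mU.
  have := module_in mU (x := r0) (y := r1) (v := r2).
  rewrite !inE eqxx rep1 orbT negb_or n20 notin // => /(_ isT isT isT).
  by rewrite arcN // hb // [arc T r2 r1]arcN // a12.
have /nontrivialP[md1 g1 _] := mod1.
have [mc1 s1] := fR r1 R1.
have [a a1 ar1] := rep_nonsource mc1 md1 g1 s1.
apply: (reducible_reps hR r0R R1 n01).
have inQ s z : s \in R -> s != r0 -> z \in f s -> z \in ~: f r0.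
  by move=> sR sr0 zs; rewrite inE (disjointFr (dR s r0 sR r0R sr0)).
(* [c] and [a] are an out- and an in-neighbour of [r1] in [~: f r0]. If [r0 |: ~: f r0] were a
   module, [f r0 :\ r0] would be a co-module avoiding [R]. *)
apply: (good_outside c0 _ (inQ r1 r1 R1 n10 rep1) (inQ r2 c R2 n20 c2)
  (inQ r1 a R1 n10 a1) r1c ar1); first by rewrite inE negbK.
apply/negP => mU.
have [z zf] : exists2 z, z \in f r0 & z \notin [set r0].
  by apply: subset_neq_ex; apply: contra ne0 => s; rewrite eqEsubset s sub1set.
rewrite inE => zr0.
have eC : ~: (f r0 :\ r0) = r0 |: ~: f r0.
  by apply/setP=> u; rewrite !inE negb_and negbK.
have cD : comodule T (f r0 :\ r0).
  apply: (module_comoduleC (x := z)); rewrite ?eC //; last by rewrite !inE zr0.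
  have := subset_leq_card (subsetUr [set r0] (~: f r0)); apply: leq_trans.
  exact: nontrivial_module_gt1 (co r0 r0R r0m).
have [s sR] := hR _ cD; rewrite !inE => /andP[sr0].
by rewrite (negbTE (notin r0 s r0R sR sr0)).
Qed.

End OddStep.
(** * Two complementary minimal co-modules *)

Section TwoComodules.
Variables (V : finType) (T : tournament V) (Q : {set V}).
Hypotheses (minQ : mincom T Q) (minQC : mincom T (~: Q)) (V5 : 5 <= #|V|).
Implicit Types (M N K A B C R : {set V}) (x y u v w : V).

(** A minimal co-module other than these two overlaps both, forcing each to have two elements,
    against [V5]. *)
Lemma two_comodules C : comodule T C -> C = Q \/ C = ~: Q.
Proof.
move=> cC; have [L mL sL] := mincom_exists cC.
have cCC : comodule T (~: C) by rewrite comoduleC.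
have [eL|nL] := eqVneq L Q.
  left; apply: setC_inj; apply: mincom_sub minQC cCC _.
  by rewrite setCS -eL.
have [eL'|nL'] := eqVneq L (~: Q).
  right; apply: setC_inj; rewrite setCK; apply: mincom_sub minQ cCC _.
  by rewrite subCset -eL'.
have meet A : mincom T A -> L != A -> exists2 z, z \in L & z \notin A.
  move=> mA nA; apply: subset_neq_ex; apply: contra nA => s.
  by rewrite (mincom_sub mA (mincom_comodule mL) s).
have [z zL] := meet _ minQC nL'; rewrite inE negbK => zQ.
have [t tL tQ] := meet _ minQ nL.
have [_ cQ _ _] := mincom_overlap mL minQ nL zL zQ.
have tQC : t \in ~: Q by rewrite inE.
have [_ cQC _ _] := mincom_overlap mL minQC nL' tL tQC.
by have := cardsC Q; rewrite cQ cQC => e; move: V5; rewrite -e.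
Qed.

Lemma near_two_comodules x y : x \in Q -> y \notin Q -> good T x y -> near T 1.
Proof.
move=> xQ yQ g; have xy := mem_neq xQ yQ; apply: (near_flip xy).
apply: near0 => C; apply/negP => /(good_comodule xy g)[/two_comodules[]->].
  by rewrite /separates xQ (negbTE yQ).
by rewrite separates_setC /separates xQ (negbTE yQ).
Qed.

Lemma near_two_large : is_module T Q -> 2 < #|Q| -> 1 < #|~: Q| -> near T 1.
Proof.
move=> mQ gQ gQC; have /card_gt0P[x xQC] := ltnW gQC.
have /card_gt0P[y yQ] := ltnW (ltnW gQ).
have [q1 q1Q /andP[q1y /eqP e1]] := mincom_nonextreme true minQ mQ gQ yQ.
have [q2 q2Q /andP[q2y /eqP e2]] := mincom_nonextreme false minQ mQ gQ yQ.
have xQ : x \notin Q by rewrite inE in xQC.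
apply: (near_two_comodules yQ xQ); apply: goodC.
apply: (good_outside mQ xQ yQ q1Q q2Q); rewrite ?e1 //; first by rewrite arcN ?e2.
apply/negP => mU; have [z zQC zx] := card_gt1_ex x gQC.
have eC : ~: (~: Q :\ x) = x |: Q by apply/setP=> u; rewrite !inE negb_and !negbK.
have cD : comodule T (~: Q :\ x).
  apply: (module_comoduleC (x := z)); rewrite ?eC //; last by rewrite in_setD1 zx.
  by rewrite cardsU1 xQ add1n ltnS ltnW // ltnW.
have := xQC; rewrite -(mincom_sub minQC cD (subD1set _ _)).
by rewrite in_setD1 eqxx.
Qed.

(** * Complementary minimal co-modules, one of them a source or a sink *)

Section Homogeneous.
Variables (s : V) (b : bool).
Hypotheses (Qs : Q = [set s]) (hs : forall v, v != s -> arc T s v = b).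

(* [bad y w] says that [[set s; w]] is a module of [flip T s y]. *)
Let bad y w := [/\ w != s, w != y, arc T y w = b &
  forall v, v != s -> v != y -> v != w -> arc T w v = b].

(** Removing [s] from an almost module at [s] leaves a module different from [Q] and [~: Q], hence
    at most one vertex [w], which is then bad. One at [y] is impossible because [s] sees all other
    vertices alike. *)
Lemma good_homogeneous_choice y : y != s -> (forall w, ~ bad y w) -> good T s y.
Proof.
move=> ys nbad K w; split=> -[sK yK uni iso] wK; apply/eqP; apply: contraT => wx;
    last first.
  have := iso w wK wx; rewrite hs ?(mem_neq wK yK) // arcN // hs //.
  by case: (b).
have esy : arc T s y = b by rewrite hs.
have out k v : k \in K -> k != s -> v \notin K -> v != y -> arc T k v = b.
  move=> kK ks vK vy; have vs : v != s by rewrite eq_sym (mem_neq sK vK).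
  rewrite arcN ?(mem_neq kK vK) // (uni v k s) // arcN //.
  by rewrite hs ?negbK.
have mL : is_module T (K :\ s).
  apply/moduleP => p q v; rewrite !inE => /andP[ps pK] /andP[qs qK].
  rewrite negb_and negbK; have [->|vs /= vK] := eqVneq v s; first by rewrite !hs.
  have [->|vy] := eqVneq v y; first by rewrite !iso.
  exact: uni.
have L1 : #|K :\ s| <= 1.
  rewrite leqNgt; apply/negP => gL.
  have /two_comodules[e|e] : comodule T (K :\ s).
    by apply: (module_comodule mL gL (v := s)); rewrite !inE eqxx.
    have : s \in K :\ s by rewrite e Qs inE.
    by rewrite !inE eqxx.
  have : y \in K :\ s by rewrite e Qs !inE.
  by rewrite inE (negbTE yK) andbF.
case: (nbad w); split=> //; first exact: (mem_neq wK yK).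
  by rewrite iso.
move=> v vs vy vw; apply: out => //; apply/negP => vK.
move/card_le1P: L1 => /(_ w); rewrite !inE wx wK => /(_ isT v).
by rewrite !inE vs vK (negbTE vw).
Qed.

Lemma near_two_homogeneous : near T 1.
Proof.
have [/existsP[y /andP[ys /forallP nbad]]|/existsPn allbad] :=
  boolP [exists y, (y != s) && [forall w, ~~ [&& w != s, w != y, arc T y w == b &
    [forall v, [==> v != s, v != y, v != w => arc T w v == b]]]]].
  apply: (@near_two_comodules s y); rewrite ?Qs ?inE //.
  apply: good_homogeneous_choice => // w [ws wy e h].
  have := nbad w; rewrite ws wy e eqxx /= => /negP; apply.
  by apply/forallP => v; apply/implyP=> ?; apply/implyP=> ?; apply/implyP=> ?;
     apply/eqP; apply: h.
have {}allbad y : y != s -> exists w, bad y w.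
  move=> ys; have := allbad y; rewrite ys /= => /forallPn[w]; rewrite negbK.
  case/and4P => ws wy /eqP e /forallP h; exists w; split=> // v vs vy vw.
  by have := h v; rewrite vs vy vw => /eqP.
have contra u v : u != v -> arc T u v = b -> arc T v u = b -> False.
  by move=> uv; rewrite arcN // => <-; case: arc.
have ex A : #|A| < #|V| -> exists v, v \notin A.
  move=> ltA; have [v _ vA] : exists2 v, v \in [set: V] & v \notin A.
    apply: subset_neq_ex; apply: contraL ltA => /subset_leq_card.
    by rewrite cardsT -leqNgt.
  by exists v.
have [y0] : exists v, v \notin [set s].
  by apply: ex; rewrite cards1; apply: leq_trans V5.
rewrite inE => y0s.
(* Reading [arc T u v = b] as dominance, a bad partner dominates all but two other vertices. Two
   vertices cannot dominate each other, so iterating partners from [y0] returns to [y0] after three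
   steps. *)
have [w0 [w0s w0y0 a0 h0]] := allbad y0 y0s.
have [w1 [w1s w1w0 a1 h1]] := allbad w0 w0s.
have w1y0 : w1 != y0 by apply/eqP => e; rewrite e in a1; exact: contra a1 a0.
have [w2 [w2s w2w1 a2 h2]] := allbad w1 w1s.
have w2w0 : w2 != w0.
  by apply/eqP => e; rewrite e in a2; apply: contra a2 a1.
have w2y0 : w2 = y0.
  apply/eqP; apply: contraT => n.
  by case: (contra w2 w0 w2w0); [apply: h2; rewrite // eq_sym|apply: h0].
rewrite {w2 w2s w2w1 w2w0}w2y0 in a2 h2.
(* This is where a fifth vertex is needed: [y0] and [w1] dominate [z], so its partner [w3] is
   neither of them, and then [w3] and [y0] dominate each other. *)
have [z] : exists v, v \notin [set s; y0; w0; w1].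
  apply: ex; apply: leq_trans V5; rewrite ltnS.
  apply: (leq_trans (leq_card_setU _ _)); rewrite cards1 addn1 ltnS.
  apply: (leq_trans (leq_card_setU _ _)); rewrite cards1 addn1 ltnS.
  by rewrite cards2; case: (_ != _).
rewrite !inE !negb_or -!andbA => /and4P[zs zy0 zw0 zw1].
have [w3 [w3s w3z a3 h3]] := allbad z zs.
have dz u : u != z -> arc T u z = b -> w3 != u.
  by move=> uz e; apply/eqP => ew; rewrite ew in a3; apply: (contra u z).
have w3y0 : w3 != y0 by apply: dz; [rewrite eq_sym|apply: h2].
case: (contra y0 w3); first by rewrite eq_sym.
  apply: h2 => //; apply: dz; first by rewrite eq_sym.
  by apply: h1.
by apply: h3; rewrite // eq_sym.
Qed.

End Homogeneous.

(** * Complementary minimal co-modules, one of them a pair of twins *)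

Section Twins.
Variables (n1 n2 : V).
Hypotheses (Qn : Q = [set n1; n2]) (n12 : arc T n1 n2) (mQ : is_module T Q).

(* A nontrivial module of [flip T n1 x] separating [n1] from [x] is either [V \ n1] (case [alpha x]) or [n1] together with one vertex [w]
   (case [beta x w]). *)
Let alpha x := arc T x n1 /\ forall v, v \notin Q -> v != x -> arc T n1 v.

Let beta x w := [/\ w \notin Q, w != x, arc T w n1, arc T x w = arc T n1 x &
  forall v, v \notin Q -> v != x -> v != w -> arc T v n1 = arc T v w].

Let n1Q : n1 \in Q. Proof. by rewrite Qn !inE eqxx. Qed.
Let n2Q : n2 \in Q. Proof. by rewrite Qn !inE eqxx orbT. Qed.

Let notinQ v : v \notin Q -> v != n1 /\ v != n2.
Proof. by rewrite Qn !inE negb_or => /andP. Qed.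

(** An almost module at [n1] misses [n2], since [x] sees the twins alike; without [n1] it is a
    module, hence a single vertex, giving [beta]. One at [x] contains [n2]; with [n1] added it is a
    module, hence all of [V], giving [alpha]. *)
Lemma good_twins_choice x : x \notin Q -> ~ alpha x -> (forall w, ~ beta x w) ->
  good T n1 x.
Proof.
move=> xQ na nb K w; have [xn1 xn2] := notinQ xQ.
have n1x : n1 != x by rewrite eq_sym.
split=> -[zK tK uni iso] wK; apply/eqP; apply: contraT => wz.
  have n2K : n2 \notin K.
    apply/negP => n2K; have n21 : n2 != n1 by rewrite eq_sym (arc_neq n12).
    have := iso n2 n2K n21; rewrite (module_in mQ n2Q n1Q xQ) arcN //.
    by case: arc.
  have n2x : n2 != x by rewrite eq_sym.
  have KQ k : k \in K -> k != n1 -> k \notin Q.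
    move=> kK kn; rewrite Qn !inE negb_or kn /=.
    exact: mem_neq kK n2K.
  have mL : is_module T (K :\ n1).
    apply/moduleP => p q v; rewrite !inE => /andP[pn pK] /andP[qn qK].
    rewrite negb_and negbK; have [->|vn /= vK] := eqVneq v n1.
      rewrite (module_out mQ n1Q n2Q (KQ p pK pn)) (module_out mQ n1Q n2Q (KQ q qK qn)).
      by move=> _; apply: uni.
    have [->|vx] := eqVneq v x; first by rewrite !iso.
    exact: uni.
  have L1 : #|K :\ n1| <= 1.
    rewrite leqNgt; apply/negP => gL.
    have /two_comodules[e|e] : comodule T (K :\ n1).
      by apply: (module_comodule mL gL (v := n1)); rewrite !inE eqxx.
      by have := n1Q; rewrite -e !inE eqxx.
    have : x \in K :\ n1 by rewrite e inE.
    by rewrite inE (negbTE tK) andbF.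
  case: (nb w); have wQ := KQ w wK wz; split=> //.
  - exact: (mem_neq wK tK).
  - have := uni n2 n1 w zK wK n2K n2x.
    rewrite -(module_out mQ n1Q n2Q wQ) [arc T n2 n1]arcN; last first.
      by rewrite eq_sym (arc_neq n12).
    by rewrite n12 /= [arc T w n1]arcN // => <-.
  - exact: iso.
  move=> v vQ vx vw; apply: uni => //; apply/negP => vK.
  have [vn1 _] := notinQ vQ.
  move/card_le1P: L1 => /(_ w); rewrite !inE wz wK => /(_ isT v).
  by rewrite !inE vn1 vK (negbTE vw).
have n2K : n2 \in K.
  apply: contraT => n2K.
  have n2n1 : n2 != n1 by rewrite eq_sym (arc_neq n12).
  have wQ : w \notin Q.
    by rewrite Qn !inE negb_or (mem_neq wK tK) (mem_neq wK n2K).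
  have := uni n2 x w zK wK n2K n2n1.
  rewrite (module_out mQ n2Q n1Q xQ) (module_out mQ n2Q n1Q wQ) (iso w wK wz) arcN //.
  by case: arc.
have ax : arc T x n1 by rewrite -(iso n2 n2K) // eq_sym.
have mU : is_module T (n1 |: K).
  have key v p : v \notin n1 |: K -> p \in n1 |: K -> arc T v p = arc T v n2.
    rewrite !inE negb_or => /andP[vn1 vK] /orP[/eqP->|pK]; last exact: uni.
    apply: (module_in mQ) => //; rewrite Qn !inE negb_or vn1 /=.
    by rewrite eq_sym (mem_neq n2K vK).
  by apply/moduleP => p q v hp hq hv; rewrite !(key v).
case: na; split=> // v vQ vx; have [vn1 _] := notinQ vQ.
rewrite (iso v) //; apply: contraT => vK.
have /two_comodules[e|e] : comodule T (n1 |: K).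
  apply: (module_comodule mU (v := v)); last by rewrite !inE negb_or vn1.
  by apply/card_gt1P; exists n1, x; rewrite !inE eqxx zK orbT.
  have := xQ; by rewrite -e !inE zK orbT.
have : n1 \in ~: Q by rewrite -e !inE eqxx.
by rewrite inE n1Q.
Qed.

Lemma near_two_twins : ~~ is_module T (~: Q) -> near T 1.
Proof.
move=> nmQC.
have gQC : 2 < #|~: Q|.
  have := cardsC Q; rewrite Qn cards2 (arc_neq n12) -Qn /= => e.
  by move: V5; rewrite -e.
have [/existsP[x /and3P[xQ nax /forallP nbx]]|/existsPn allbad] :=
  boolP [exists x, [&& x \notin Q,
    ~~ (arc T x n1 && [forall v, [==> v \notin Q, v != x => arc T n1 v]]) &
    [forall w, ~~ [&& w \notin Q, w != x, arc T w n1, arc T x w == arc T n1 x &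
      [forall v, [==> v \notin Q, v != x, v != w => arc T v n1 == arc T v w]]]]]].
  apply: (near_two_comodules n1Q xQ); apply: good_twins_choice => //.
    case=> ax hx; case/negP: nax; rewrite ax; apply/forallP => v.
    by apply/implyP => ?; apply/implyP => ?; apply: hx.
  move=> w [wQ wx wn e h]; have /negP := nbx w; apply; rewrite wQ wx wn e eqxx /=.
  by apply/forallP => v; apply/implyP=> ?; apply/implyP=> ?; apply/implyP=> ?;
     apply/eqP; apply: h.
have {}allbad x : x \notin Q -> alpha x \/ exists w, beta x w.
  move=> xQ; have := allbad x; rewrite xQ /= negb_and negbK => /orP[|/forallPn[w]].
    move=> /andP[ax /forallP hx]; left; split=> // v vQ vx.
    by have := hx v; rewrite vQ vx.
  rewrite negbK => /and5P[wQ wx wn /eqP e /forallP h]; right; exists w; split=> //.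
  by move=> v vQ vx vw; have := h v; rewrite vQ vx vw => /eqP.
have anti u v : u != v -> arc T u v = false -> arc T v u = false -> False.
  by move=> uv; rewrite arcN // => /negbFE ->.
have anti1 u : arc T u n1 -> arc T n1 u = false.
  by move=> un; apply: contraTF un => nu; rewrite arcN 1?eq_sym ?nu // (arc_neq nu).
have /card_gt2P[x0 [x1 [x2 [[m0 m1 m2] [d01 d12 d20]]]]] := gQC.
rewrite !inE in m0 m1 m2.
(* Under [alpha x], the only in-neighbour of [n1] outside [Q] is [x]. Every other vertex outside [Q]
   then has [x] as its [beta] partner, and two such vertices already conflict. *)
have noalpha x : x \notin Q -> ~ alpha x.
  move=> xQ [ax hx].
  have b x' : x' \notin Q -> x' != x -> beta x' x.
    move=> x'Q x'x; have [[ax' _]|[w bw]] := allbad x' x'Q.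
      by have := hx x' x'Q x'x; rewrite (anti1 _ ax').
    have [wQ _ wn _ _] := bw; have [<-//|wx] := eqVneq w x.
    by have := hx w wQ wx; rewrite (anti1 _ wn).
  have two u v : u \notin Q -> v \notin Q -> u != v -> u != x -> v != x -> False.
    move=> uQ vQ uv ux vx; have [_ _ _ _ h] := b u uQ ux.
    have [_ _ _ e _] := b v vQ vx.
    have := h v vQ; rewrite eq_sym => /(_ uv vx).
    rewrite e; have nv := hx v vQ vx; rewrite nv => vn.
    by have := anti1 v vn; rewrite nv.
  have [e0|n0] := eqVneq x0 x.
    by apply: (two x1 x2) => //; rewrite -e0 // eq_sym.
  have [e1|n1'] := eqVneq x1 x; last by apply: (two x0 x1).
  by apply: (two x2 x0) => //; rewrite -e1 eq_sym.
have allbeta x : x \notin Q -> exists w, beta x w.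
  by move=> xQ; case: (allbad x xQ) => // /(noalpha x xQ).
clear allbad noalpha.
have [w1 [w1Q w1x w1n e1 h1]] := allbeta x0 m0.
have [w2 [w2Q w2w1 w2n e2 h2]] := allbeta w1 w1Q.
rewrite (anti1 _ w1n) in e2.
have w2x : w2 != x0.
  apply/eqP => e; rewrite e in w2n e2; rewrite (anti1 _ w2n) in e1.
  by apply: (anti w1 x0).
have [w3 [w3Q w3w2 w3n e3 h3]] := allbeta w2 w2Q.
rewrite (anti1 _ w2n) in e3.
have w3w1 : w3 != w1.
  by apply/eqP => e; rewrite e in e3; apply: (anti w2 w1).
have w1w3 : w1 != w3 by rewrite eq_sym.
have w1w2 : w1 != w2 by rewrite eq_sym.
have w3x : w3 = x0.
  apply/eqP; apply: contraT => n.
  have := h1 w3 w3Q n w3w1; have := h3 w1 w1Q w1w2 w1w3.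
  rewrite w1n w3n => a c; have := arcN T w1w3; by rewrite -a -c.
rewrite {w3 w3Q w3w2 w3w1 w1w3}w3x in w3n e3 h3.
have eqs v : v \notin Q -> v != x0 -> v != w1 -> v != w2 ->
    [/\ arc T v w1 = arc T v n1, arc T v w2 = arc T v n1 & arc T v x0 = arc T v n1].
  by move=> vQ v0 v1 v2; split; [rewrite -h1|rewrite -h2|rewrite -h3].
(* The [beta] partners close into a cycle [x0], [w1], [w2], and every vertex outside [U] sees these
   three as it sees [n1]. So [U] is a module, hence all of [V]; as the three dominate the twins,
   [~: Q] is a module after all. *)
pose U := Q :|: [set x0; w1; w2].
have mU : is_module T U.
  have key v p : v \notin U -> p \in U -> arc T v p = arc T v n1.
    rewrite /U !inE !negb_or -!andbA => /and4P[vQ v0 v1 v2].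
    have [q1 q2 q3] := eqs v vQ v0 v1 v2.
    rewrite -!orbA => /or4P[pQ|/eqP->|/eqP->|/eqP->] //; exact: (module_in mQ).
  by apply/moduleP => p q v hp hq hv; rewrite !(key v).
have full v : v \in U.
  apply: contraT => vU.
  have /two_comodules[e|e] : comodule T U.
    apply: (module_comodule mU _ vU); apply/card_gt1P; exists n1, n2.
    by rewrite !inE n1Q n2Q (arc_neq n12).
    by case/negP: m0; rewrite -e !inE eqxx orbT.
  have : n1 \in ~: Q by rewrite -e inE n1Q.
  by rewrite inE n1Q.
case/negP: nmQC; apply/moduleP.
have key v p : v \in Q -> p \notin Q -> arc T v p = false.
  move=> vQ pQ; rewrite (module_out mQ vQ n1Q pQ); apply: anti1.
  by have := full p; rewrite !inE (negbTE pQ) /= -orbA => /or3P[] /eqP->.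
by move=> p q v; rewrite !inE negbK => pQ qQ vQ; rewrite !key.
Qed.

End Twins.
End TwoComodules.

(** * Assembly of the upper bound *)

Section UpperBound.
Variable (V : finType).
Implicit Types (T : tournament V) (Q R : {set V}).

Lemma near_complementary T Q : mincom T Q -> mincom T (~: Q) -> 5 <= #|V| ->
  near T 1.
Proof.
wlog mQ : Q / nontrivial_module T Q.
  move=> wl mQ mQC V5; case/orP: (mincom_comodule mQ) => h; first exact: (wl Q).
  by apply: (wl (~: Q)) => //; rewrite setCK.
move=> minQ minQC V5; have /nontrivialP[modQ gQ _] := mQ.
have [g1|le1] := ltnP 1 #|~: Q|; last first.
  have [s sQC] := comodule_neq0 (mincom_comodule minQC).
  have eQ : ~: Q = [set s].
    by apply/eqP; rewrite eq_sym eqEcard sub1set sQC cards1.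
  have mC : is_module T (~: [set s]) by rewrite -eQ setCK.
  have [b hb] := homogeneous_of_module mC.
  have minQ' : mincom T (~: ~: Q) by rewrite setCK.
  exact: (near_two_homogeneous minQC minQ' V5 eQ hb).
have [g2|le2] := ltnP 2 #|Q|; first exact: (near_two_large minQ minQC V5).
have Q2 : #|Q| = 2 by apply/eqP; rewrite eqn_leq le2 gQ.
have [mQC|nmQC] := boolP (is_module T (~: Q)).
  have minQ' : mincom T (~: ~: Q) by rewrite setCK.
  apply: (near_two_large minQC minQ' V5 mQC); last by rewrite setCK.
  by have := cardsC Q; rewrite Q2 => e; rewrite -e in V5.
have Q0 : Q != set0 by rewrite -card_gt0 Q2.
have [n2 [n2Q sn2]] := sink_rep_exists T Q0.
have [n1 [n1Q n12 eQ]] := card2_other Q2 n2Q.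
exact: (near_two_twins minQ minQC V5 eQ (sn2 Q2 n1 n1Q n12) modQ nmQC).
Qed.

Lemma near_uphalf_Delta T : 5 <= #|V| -> near T (uphalf (Delta T)).
Proof.
move=> V5; move: {2}(Delta T) (leqnn (Delta T)) => n; elim: n T => [|n IHn] T.
  rewrite leqn0 => /eqP D0; rewrite D0; apply: near0 => C; apply/negP => cC.
  have [R [f repR]] := representatives_exist T.
  have := Delta_representatives repR; rewrite D0 leqn0 cards_eq0 => /eqP R0.
  by have [_ _ /(_ C cC)[r]] := repR; rewrite R0 inE.
move=> leD; have [R [f repR]] := representatives_exist T.
have [fR dR hR] := repR.
have leR := Delta_representatives repR.
have [oddR|evenR] := boolP (odd #|R|).
  (* [R] also hits the complement of [f r], so an odd [#|R|] is at least three. *)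
  have gR : 2 < #|R|.
    have /card_gt0P[r rR] : 0 < #|R| by case: #|R| oddR.
    have [minr [rr _]] := fR r rR.
    have [s sR] : exists2 s, s \in R & s \in ~: f r.
      by apply: hR; rewrite comoduleC mincom_comodule.
    rewrite inE => sr; have : 1 < #|R|.
      by apply/card_gt1P; exists r, s; split=> //; apply: mem_neq rr sr.
    by case: #|R| oddR => [|[|[]]].
  have [x [y [R' [xy g hR' ltR]]]] := reducible_odd repR gR.
  (* As [#|R|] is odd, losing one representative lowers [uphalf] by one, which pays for the flip. *)
  have D' := Delta_hitting hR'.
  have := IHn (flip T x y); rewrite -ltnS => /(_ _)/(near_flip xy) nf.
  apply: near_le (nf _); last first.
    exact: leq_ltn_trans D' (leq_trans ltR (leq_trans leR leD)).
  apply: (@leq_trans (uphalf #|R|)); last exact: uphalf_leq.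
  have : uphalf (Delta (flip T x y)) <= uphalf #|R'| by apply: uphalf_leq.
  have : uphalf #|R'| <= uphalf #|R|.-1.
    by apply: uphalf_leq; rewrite -ltnS prednK // (leq_ltn_trans _ gR).
  move=> h1 h2; apply: (@leq_ltn_trans _ _ _ (leq_trans h2 h1)).
  move: oddR gR; case: #|R| => //= m; rewrite uphalf_half => /negbTE-> _.
  by rewrite add0n.
have [/existsP[r /existsP[r' /and4P[rR r'R rr' /eqP full]]]|/existsPn no] :=
    boolP [exists r, exists r', [&& r \in R, r' \in R, r != r' &
             f r :|: f r' == setT]].
  have eC : f r' = ~: f r.
    apply/eqP; rewrite eqEsubset -disjoints_subset disjoint_sym dR //=.
    apply/subsetP => z; rewrite inE => zr.
    by have : z \in f r :|: f r' by [rewrite full inE]; rewrite inE (negbTE zr).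
  have [minr _] := fR r rR; have [minr' _] := fR r' r'R; rewrite eC in minr'.
  apply: near_le (near_complementary minr minr' V5).
  have : 1 < #|R| by apply/card_gt1P; exists r, r'.
  by move/leq_trans/(_ leR); case: (Delta T) => [|[|d]].
have : near T #|R|./2.
  apply: (near_representatives_even repR evenR) => r r' rR r'R rr'.
  have := no r; move/existsPn/(_ r'); rewrite rR r'R rr' /=.
  rewrite -subTset => /subset_neq_ex[t _ tU]; by exists t.
apply: near_le; apply: leq_trans (half_leq leR) _.
by rewrite uphalf_half leq_addl.
Qed.

End UpperBound.
(** * The two bounds and vertex deletion *)

Section Bounds.
Variable (V : finType).
Implicit Types (T S : tournament V) (C R X : {set V}) (B : {set V * V}).

Lemma eq_arcs_indecomposable T S : arcs T = arcs S ->
  indecomposable T = indecomposable S.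
Proof. by rewrite /indecomposable /is_module => ->. Qed.

Lemma near_delta T m : near T m -> delta T <= m.
Proof.
case=> S iS; apply: leq_trans; apply: delta_le; first exact: subsetDl.
rewrite (@eq_arcs_indecomposable _ S) //; apply/setP => -[u v].
rewrite mem_inv_arcs !inE negb_and negbK -!/(arc _ _ _).
have [->|uv] := eqVneq u v; first by rewrite !arcxx.
rewrite [arc T v u]arcN 1?eq_sym // [arc S v u]arcN 1?eq_sym //.
by case: (arc T u v); case: (arc S u v).
Qed.

Lemma delta_uphalf_Delta T : 5 <= #|V| -> delta T <= uphalf (Delta T).
Proof. by move=> V5; apply: near_delta; apply: near_uphalf_Delta. Qed.

Lemma Delta_separating T B :
  (forall C, comodule T C -> exists2 p, p \in B & separates C p.1 p.2) ->
  Delta T <= #|B|.*2.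
Proof.
move=> sepB; pose R := [set p.1 | p in B] :|: [set p.2 | p in B].
apply: (@leq_trans #|R|).
  apply: Delta_hitting => C /sepB[p pB]; rewrite /separates.
  have [p1C _|p1C p2C] := boolP (p.1 \in C).
    by exists p.1 => //; rewrite inE imset_f.
  exists p.2; first by rewrite inE imset_f ?orbT.
  by case: (_ \in _) p2C.
by rewrite -addnn (leq_trans (leq_card_setU _ _)) // leq_add // leq_imset_card.
Qed.

Lemma module_inv T B C : (forall p, p \in B -> ~~ separates C p.1 p.2) ->
  is_module T C -> is_module (Defs.inv T B) C.
Proof.
move=> nB mC.
have key u v : u \in C -> v \notin C -> arc (Defs.inv T B) v u = arc T v u.
  move=> uC vC; rewrite /arc /= mem_inv_arcs.
  have /negbTE-> : (v, u) \notin B.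
    by apply/negP => /nB /=; rewrite /separates uC (negbTE vC).
  have /negbTE-> : (u, v) \notin B.
    by apply/negP => /nB /=; rewrite /separates uC (negbTE vC).
  by rewrite andbT andbF orbF.
by apply/moduleP => x y v xC yC vC; rewrite !key // (module_in mC xC yC vC).
Qed.

Lemma comodule_inv T B C : (forall p, p \in B -> ~~ separates C p.1 p.2) ->
  comodule T C -> comodule (Defs.inv T B) C.
Proof.
move=> nB /orP[] /andP[mC nC]; apply/orP; [left|right]; apply/andP; split=> //.
  exact: module_inv.
by apply: module_inv mC => p /nB; rewrite separates_setC.
Qed.

Lemma Delta_delta T : Delta T <= (delta T).*2.
Proof.
have [/existsP[B0 /andP[sB0 iB0]]|/existsPn no] :=
    boolP [exists B : {set V * V}, (B \subset arcs T) && indecomposable (Defs.inv T B)].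
  have [|B [_ iB <-]] := @delta_attained V T; first by exists B0.
  apply: Delta_separating => C cC; apply/exists_inP; apply: contraT => /exists_inPn nB.
  by have := indecomposableP _ iB C; rewrite (comodule_inv nB cC).
(* With no admissible [B], the minimum takes its neutral value; the set of all arcs then plays the
   part of [B], since it separates every co-module. *)
have -> : delta T = #|arcs T|.
  by rewrite /delta big_pred0 // => B; apply/negbTE/no.
apply: Delta_separating => C cC.
have [[x xC] [y yC]] := (comodule_neq0 cC, comodule_compl cC).
have [a|a] := boolP (arc T x y).
  by exists (x, y) => //=; rewrite /separates xC (negbTE yC).
exists (y, x); last by rewrite /separates /= xC (negbTE yC).
by have : arc T y x by rewrite arcN // eq_sym (mem_neq xC yC).
Qed.

Lemma ex_subset_card (A : {set V}) k : k <= #|A| ->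
  exists2 X : {set V}, X \subset A & #|X| = k.
Proof.
move=> le; exists [set x in take k (enum A)].
  by apply/subsetP => x; rewrite inE => /mem_take; rewrite mem_enum.
rewrite cardsE; have /card_uniqP -> : uniq (take k (enum A)).
  by rewrite take_uniq // enum_uniq.
by rewrite size_take -cardE; case: ltngtP le.
Qed.

End Bounds.

(** * Co-modules that survive the deletion of vertices *)

Section Deletion.
Variables (V : finType) (T : tournament V) (X : {set V}).
Implicit Types (C R : {set V}).

Definition restrict C : {set {x : V | x \notin X}} := [set w | val w \in C].

Lemma card_restrict C : #|restrict C| = #|C :\: X|.
Proof.
rewrite -(card_imset (restrict C) val_inj); congr #|pred_of_set _|.
apply/setP => x; apply/imsetP/idP => [[w]|]; rewrite !inE.
  by move=> wC ->; rewrite wC (valP w).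
by case/andP => xX xC; exists (Sub x xX); rewrite ?inE SubK.
Qed.

Lemma module_restrict C : is_module T C -> is_module (del T X) (restrict C).
Proof.
move=> mC; apply/moduleP => x y v; rewrite !inE => xC yC vC.
by have := module_in mC xC yC vC; rewrite /arc !inE.
Qed.

Lemma comodule_restrict C v : is_module T C -> 1 < #|C :\: X| ->
  v \notin C -> v \notin X -> comodule (del T X) (restrict C).
Proof.
move=> mC gC vC vX.
apply: (module_comodule (module_restrict mC) (v := Sub v vX)).
  by rewrite card_restrict.
by rewrite inE SubK.
Qed.

Lemma Delta_del_family (R : {set V}) (f : V -> {set V}) :
  (forall r, r \in R -> r \in f r /\ r \notin X) ->
  (forall r, r \in R -> comodule (del T X) (restrict (f r))) ->
  (forall r r', r \in R -> r' \in R -> r != r' -> [disjoint f r & f r']) ->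
  #|R| <= Delta (del T X).
Proof.
move=> rR cR dR; pose g r := restrict (f r).
have dg r r' : r \in R -> r' \in R -> r != r' -> [disjoint g r & g r'].
  move=> rR' r'R rr'; apply/pred0P => w; rewrite /= !inE.
  by have /pred0P/(_ (val w)) := dR r r' rR' r'R rr'.
have injg : {in R &, injective g}.
  move=> r r' rR' r'R e; apply/eqP; apply: contraT => rr'.
  have [rf rX] := rR r rR'.
  have := dg r r' rR' r'R rr'; rewrite -e => /pred0P/(_ (Sub r rX)) /=.
  by rewrite !inE SubK rf.
rewrite -(card_in_imset injg); apply: (bigmax_sup (g @: R)) => //.
apply/andP; split; last by apply/forall_inP => M /imsetP[r rR' ->]; apply: cR.
apply/trivIsetP => M N /imsetP[r rR' ->] /imsetP[r' r'R ->] nMN.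
by apply: dg => //; apply: contraNneq nMN => ->.
Qed.

End Deletion.

(** * Choice of the deleted set *)

Section Part1.
Variables (V : finType) (T : tournament V).
Implicit Types (R X : {set V}).

(** A tournament has at most one source and at most one sink. *)
Lemma homogeneous_le2 R : (forall r, r \in R -> is_module T (~: [set r])) ->
  #|R| <= 2.
Proof.
move=> hR; rewrite leqNgt; apply/negP => /card_gt2P[x [y [z [[xR yR zR]]]]].
case=> xy yz zx.
have [b hb] := homogeneous_of_module (hR x xR).
have [c hc] := homogeneous_of_module (hR y yR).
have [d hd] := homogeneous_of_module (hR z zR).
have [[yx zy] xz] : (y != x) * (z != y) * (x != z).
  by rewrite [y == x]eq_sym [z == y]eq_sym [x == z]eq_sym.
have := arcN T xy; have := arcN T yz; have := arcN T zx.
rewrite !(hb, hc, hd) //.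
by case: (b); case: (c); case: (d).
Qed.

Lemma Delta_del k : 1 <= k <= 4 -> 3 + k <= #|V| ->
  exists X : {set V}, #|X| = k /\ Delta T <= Delta (del T X) + 2.
Proof.
move=> /andP[_ k4] Vk; have [R [f repR]] := representatives_exist T.
have [fR dR hR] := repR; have leD := Delta_hitting hR.
have [R3|R4] := leqP #|R| 3.
  have [R2|R3'] := leqP #|R| 2.
    have [|X _ cX] := @ex_subset_card V [set: V] k.
      by rewrite cardsT (leq_trans _ Vk) // leq_addl.
    by exists X; split=> //; rewrite (leq_trans leD) // (leq_trans R2) // leq_addl.
  have /card_gt0P[r rR] : 0 < #|R| by apply: leq_trans R3'.
  have [minr _] := fR r rR.
  have [Q [mQ gQ [v vQ]]] : exists Q, [/\ is_module T Q, 1 < #|Q| & exists v, v \notin Q].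
    case/orP: (mincom_comodule minr) => /nontrivialP h; first by exists (f r).
    by exists (~: f r).
  have /card_gt1P[q1 [q2 [q1Q q2Q q12]]] := gQ.
  (* Two vertices of a module and one outside it keep [T - X] decomposable; they are the 3 in
     [3 + k]. *)
  have [|X sX cX] := @ex_subset_card V (~: [set q1; q2; v]) k.
    rewrite -(leq_add2l #|[set q1; q2; v]|) cardsC; apply: leq_trans Vk.
    rewrite leq_add2r (leq_trans (leq_card_setU _ _)) // cards1 cards2.
    by case: (_ != _).
  exists X; split=> //; apply: (leq_trans leD); apply: (leq_trans R3).
  rewrite -[3]/(1 + 2) leq_add2r.
  have out z : z \in [set q1; q2; v] -> z \notin X.
    by move=> zQ; apply: contraL zQ => /(subsetP sX); rewrite inE.
  have cQ : comodule (del T X) (restrict X Q).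
    apply: (comodule_restrict mQ _ vQ); last by apply: out; rewrite !inE eqxx !orbT.
    apply/card_gt1P; exists q1, q2; rewrite !in_setD q1Q q2Q.
    by rewrite !out // !inE eqxx ?orbT.
  rewrite -(cards1 q1); apply: (@Delta_del_family V T X [set q1] (fun=> Q)).
  - by move=> z; rewrite inE => /eqP->; split=> //; apply: out; rewrite !inE eqxx.
  - by move=> z _; exact: cQ.
  by move=> z z'; rewrite !inE => /eqP-> /eqP->; rewrite eqxx.
have compl r : r \in R -> ~~ nontrivial_module T (f r) -> is_module T (~: f r).
  move=> rR nr; have [/mincom_comodule/orP[h|/nontrivialP[//]] _] := fR r rR.
  by rewrite h in nr.
have inf r : r \in R -> r \in f r by move=> rR; have [_ []] := fR r rR.
have notin r s : r \in R -> s \in R -> s != r -> s \notin f r.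
  by move=> rR sR sr; rewrite (disjointFr (dR s r sR rR sr)) // inf.
(* Singletons come from a source or a sink, so two representatives have sets with at least two
   elements each. Their union has room for [X] because [k <= 4]. *)
pose S := [set r in R | #|f r| <= 1].
have S2 : #|S| <= 2.
  apply: homogeneous_le2 => r; rewrite inE => /andP[rR r1].
  have <- : f r = [set r].
    by apply/eqP; rewrite eq_sym eqEcard sub1set inf // cards1.
  apply: compl => //; apply/negP => /nontrivial_module_gt1.
  by rewrite ltnNge r1.
have : 1 < #|R :\: S|.
  have eS : R :&: S = S.
    by apply/setIidPr/subsetP => r; rewrite inE => /andP[].
  rewrite -(leq_add2l #|R :&: S|) cardsID eS (leq_trans _ R4) //.
  by rewrite -[4]/(2 + 2) leq_add2r.
case/card_gt1P => r1 [r2 []]; rewrite !inE !negb_and -!ltnNge.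
have big r : (r \notin R) || (1 < #|f r|) -> r \in R -> 1 < #|f r|.
  by move=> h rR; move: h; rewrite rR.
move=> /andP[h1 R1] /andP[h2 R2] r12.
have g1 := big _ h1 R1; have g2 := big _ h2 R2.
have [|X sX cX] := @ex_subset_card V (f r1 :|: f r2) k.
  rewrite cardsU (_ : f r1 :&: f r2 = set0) ?cards0 ?subn0.
    by apply: (leq_trans k4); apply: (leq_add g1 g2).
  by apply/eqP; rewrite setI_eq0 dR.
exists X; split=> //; apply: (leq_trans leD).
pose R' := R :\ r1 :\ r2.
have cR : #|R| = (#|R'| + 2)%N.
  by rewrite (cardsD1 r1 R) R1 (cardsD1 r2 (R :\ r1)) !inE eq_sym r12 R2 addnA addnC.
rewrite cR leq_add2r.
have R'P r : r \in R' -> [/\ r \in R, r != r1 & r != r2].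
  by rewrite !inE => /and3P[].
have dX r : r \in R' -> [disjoint f r & X].
  case/R'P => rR n1 n2; apply/pred0P => z /=; apply/negP => /andP[zr].
  move/(subsetP sX); rewrite inE (disjointFr (dR r r1 rR R1 n1) zr).
  by rewrite (disjointFr (dR r r2 rR R2 n2) zr).
have notX r z : r \in R' -> z \in f r -> z \notin X.
  by move=> /dX d zr; rewrite (disjointFr d zr).
have subR r : r \in R' -> r \in R by case/R'P.
have fX r : r \in R' -> f r :\: X = f r.
  by move=> rR'; apply/setDidPl; apply: dX.
have nt r s : r \in R' -> s \in R' -> s != r -> nontrivial_module T (f r) ->
    comodule (del T X) (restrict X (f r)).
  move=> rR' sR' sr /nontrivialP[mr gr _].
  apply: (comodule_restrict (v := s) mr); first by rewrite fX.
    by apply: notin => //; apply: subR.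
  by apply: (notX s) => //; apply: inf; apply: subR.
apply: (@Delta_del_family V T X R' f) => [r rR'|r rR'|r r' /subR rR /subR r'R].
- by split; [apply: inf; apply: subR|apply: (notX r) => //; apply: inf; apply: subR].
- have rR := subR r rR'.
  have [s sR' sr] : exists2 s, s \in R' & s != r.
    by apply: card_gt1_ex; move: R4; rewrite cR addn2 !ltnS.
  have sR := subR s sR'.
  have [nr|nr] := boolP (nontrivial_module T (f r)); first exact: (nt r s).
  have mC := compl r rR nr.
  have [gC|leC] := ltnP 1 #|~: f r :\: X|.
    have -> : restrict X (f r) = ~: restrict X (~: f r).
      by apply/setP => w; rewrite !inE negbK.
    rewrite comoduleC; apply: (comodule_restrict (v := r) mC gC).
      by rewrite inE negbK inf.
    by apply: (notX r) => //; apply: inf.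
  (* When only [s] survives outside [f r], the complement is of no use. But then [f s] is a
     singleton whose complement is a module, so [f r] is a module too, and it has two elements
     because three vertices survive. *)
  have eC z : z \in ~: f r :\: X -> z = s.
    move=> zC; have sC : s \in ~: f r :\: X.
      by rewrite !inE notin // andbT; apply: (notX s) => //; apply: inf.
    apply/eqP; apply: contraLR leC => zs; rewrite -ltnNge.
    by apply/card_gt1P; exists z, s.
  have es : f s = [set s].
    apply/setP => z; rewrite inE; apply/idP/eqP => [zs|->]; last exact: inf.
    apply: eC; rewrite !inE (notX s) //= (disjointFr _ zs) //.
    exact: dR.
  have gr : 1 < #|f r|.
    have : 3 <= #|~: X|.
      by rewrite -(leq_add2r #|X|) addnC [X in _ <= X]addnC cardsC cX addnC.
    have : ~: X \subset s |: f r.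
      apply/subsetP => z; rewrite !inE => zX.
      have [|zr] := boolP (z \in f r); first by rewrite orbT.
      by rewrite (eC z) ?eqxx // !inE zX zr.
    move/subset_leq_card => h1' h2'; have := leq_trans h2' h1'.
    by rewrite cardsU1 notin.
  have mS : is_module T (~: f s).
    apply: compl => //; apply/negP => /nontrivial_module_gt1.
    by rewrite es cards1.
  apply: (nt r s) => //; apply/nontrivialP; split=> //; last first.
    by exists s; apply: notin.
  apply: (@comodules_modules V T (f r) (f s) r1 _ _ mC mS).
  + by apply: dR; rewrite // eq_sym.
  + have [_ n1 _] := R'P r rR'; have [_ n1' _] := R'P s sR'.
    by rewrite inE negb_or !notin // eq_sym.
  by apply/set0Pn; exists s; apply: inf.
exact: dR.
Qed.

End Part1.

Theorem theorem5 (k : nat) (hk : 1 <= k <= 4) :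
  (forall (V : finType) (T : tournament V), 3 + k <= #|V| ->
     exists X : {set V}, #|X| = k /\ Delta T <= Delta (del T X) + 2) /\
  (forall (V : finType) (T : tournament V), 5 + k <= #|V| ->
     exists X : {set V}, #|X| = k /\ delta T <= delta (del T X) + 1).
Proof.
split=> V T Vk; first exact: Delta_del.
have [|X [cX leD]] := Delta_del T hk; first by apply: leq_trans Vk; rewrite leq_add2r.
have V5 : 5 <= #|V| by apply: leq_trans Vk; rewrite leq_addr.
exists X; split=> //; apply: leq_trans (delta_uphalf_Delta T V5) _.
(* Adding 2 to [Delta] adds exactly 1 to its [uphalf], and nothing is lost in rounding because the
   bound on [Delta (del T X)] is even. *)
apply: leq_trans (uphalf_leq leD) _; rewrite addn2 /= addn1 ltnS.
by apply: leq_trans (uphalf_leq (Delta_delta _)) _; rewrite uphalf_double.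
Qed.
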